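(* Let $E_1,\ldots,E_m,F$ be Archimedean Riesz spaces and let $A\colon E_1\times\cdots\times E_m\to F$ be a regular $m$-linear operator. If $A$ is disjointness preserving, then all Arens extensions of $A$ are disjointness preserving on $(E_1^\sim)_n^\sim\times\cdots\times(E_m^\sim)_n^\sim$; that is, for every permutation $\rho\in S_m$, the restriction $$AR_m^\rho(A)\colon (E_1^\sim)_n^\sim\times\cdots\times(E_m^\sim)_n^\sim\to F^{\sim\sim}$$ is disjointness preserving.
   Context: Riesz spaces are real. $E^\sim$ is the order dual of a Riesz space $E$, $E^{\sim\sim}=(E^\sim)^\sim$, and $(E^\sim)_n^\sim\subseteq E^{\sim\sim}$ is the subspace of all order continuous functionals on $E^\sim$. $S_m$ is the set of permutations of $\{1,\ldots,m\}$. Vectors $x,y$ are disjoint, $x\perp y$, if $|x|\wedge|y|=0$. An $m$-linear operator between Riesz spaces is positive if it takes positive values at $m$-tuples of positive vectors, and regular if it is a difference of two positive $m$-linear operators; $\mathcal L_r(E_1,\ldots,E_m)$ is the space of regular $m$-linear forms. Regular operators are order bounded (they send order bounded sets, for the coordinatewise order, to order bounded sets). An order bounded $m$-linear operator is disjointness preserving if it is so separately: for every $j$ and all fixed $x_i\in E_i$, $i\ne j$, the linear operator $x_j\mapsto A(x_1,\ldots,x_m)$ sends disjoint vectors to disjoint vectors. Arens extensions: let $\rho\in S_m$. For $i=1,\ldots,m-1$ and $x_{\rho(i)}^{\sim\sim}\in E_{\rho(i)}^{\sim\sim}$ define $\overline{x_{\rho(i)}^{\sim\sim}}\colon\mathcal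 L_r(E_{\rho(i)},\ldots,E_{\rho(m)})\to\mathcal L_r(E_{\rho(i+1)},\ldots,E_{\rho(m)})$ by $\overline{x_{\rho(i)}^{\sim\sim}}(B)=x_{\rho(i)}^{\sim\sim}\circ B^i$, where $B^i\colon E_{\rho(i+1)}\times\cdots\times E_{\rho(m)}\to E_{\rho(i)}^\sim$, $B^i(x_{i+1},\ldots,x_m)(x_i)=B(x_i,x_{i+1},\ldots,x_m)$ for $x_k\in E_{\rho(k)}$; for $i=m$ put $\overline{x_{\rho(m)}^{\sim\sim}}=x_{\rho(m)}^{\sim\sim}\colon E_{\rho(m)}^\sim\to\mathbb R$. For an $m$-linear form $C$ on $E_1\times\cdots\times E_m$ let $C_\rho\colon E_{\rho(1)}\times\cdots\times E_{\rho(m)}\to\mathbb R$, $C_\rho(x_1,\ldots,x_m)=C(x_{\rho^{-1}(1)},\ldots,x_{\rho^{-1}(m)})$. The Arens extension of a regular $m$-linear operator $A\colon E_1\times\cdots\times E_m\to F$ with respect to $\rho$ is the (regular) $m$-linear operator $AR_m^\rho(A)\colon E_1^{\sim\sim}\times\cdots\times E_m^{\sim\sim}\to F^{\sim\sim}$, $$AR_m^\rho(A)(x_1^{\sim\sim},\ldots,x_m^{\sim\sim})(y^\sim)=\big(\overline{x_{\rho(m)}^{\sim\sim}}\circ\cdots\circ\overline{x_{\rho(1)}^{\sim\sim}}\big)((y^\sim\circ A)_\rho),\quad y^\sim\in F^\sim.$$ *)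

(* Defs.v *)
From HB Require Import structures.
From mathcomp Require Import all_boot all_order all_algebra all_fingroup.
From mathcomp Require Import boolp classical_sets functions reals.

Set Implicit Arguments.
Unset Strict Implicit.
Unset Printing Implicit Defensive.

Import Order.TTheory GRing.Theory Num.Theory.
Local Open Scope classical_set_scope.
Local Open Scope ring_scope.

(* The lattice operations are part of the mixin because MathComp has no join of
   latticeType with lmodType. *)
HB.mixin Record POrderedLmodule_isRiesz (R : numDomainType) E
    of GRing.Lmodule R E & Order.POrder ring_display E := {
  riesz_lerD2r : forall z x y : E, x <= y -> x + z <= y + z;
  riesz_scaler_ge0 : forall (a : R) (x : E), 0 <= a -> 0 <= x -> 0 <= a *: x;
  riesz_meet : E -> E -> E;
  riesz_join : E -> E -> E;
  riesz_meetP : forall z x y : E, (z <= riesz_meet x y) = (z <= x) && (z <= y);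
  riesz_joinP : forall x y z : E, (riesz_join x y <= z) = (x <= z) && (y <= z)
}.

#[short(type="rieszType")]
HB.structure Definition Riesz (R : numDomainType) :=
  { E of GRing.Lmodule R E & Order.POrder ring_display E
       & POrderedLmodule_isRiesz R E }.

Definition archimedean_riesz (R : numDomainType) (E : rieszType R) : Prop :=
  forall x y : E, 0 <= x -> 0 <= y -> (forall n : nat, x *+ n <= y) -> x = 0.

Definition riesz_abs (R : numDomainType) (E : rieszType R) (x : E) : E :=
  riesz_join x (- x).

Definition riesz_disjoint (R : numDomainType) (E : rieszType R) (x y : E) : Prop :=
  riesz_meet (riesz_abs x) (riesz_abs y) = 0.

Definition order_bounded (R : numDomainType) (E F : rieszType R) (f : E -> F) : Prop :=
  forall a b : E, exists c d : F, forall x, a <= x <= b -> c <= f x <= d.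

Section RieszTheory.
Variables (R : numDomainType) (E : rieszType R).
Implicit Types x y z : E.

Lemma riesz_leD2r z x y : (x + z <= y + z) = (x <= y).
Proof.
apply/idP/idP; last exact: riesz_lerD2r.
by move=> /(riesz_lerD2r (- z)); rewrite !addrK.
Qed.

Lemma riesz_leD2l z x y : (z + x <= z + y) = (x <= y).
Proof. by rewrite ![z + _]addrC riesz_leD2r. Qed.

Lemma riesz_leD x y z t : x <= y -> z <= t -> x + z <= y + t.
Proof. by move=> xy zt; rewrite (@le_trans _ _ (y + z)) ?riesz_leD2r ?riesz_leD2l. Qed.

Lemma riesz_subr_ge0 x y : (0 <= y - x) = (x <= y).
Proof. by rewrite -(riesz_leD2r x 0) add0r subrK. Qed.

Lemma riesz_oppr_le0 x : (- x <= 0) = (0 <= x).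
Proof. by rewrite -(riesz_leD2r x (- x)) addNr add0r. Qed.

Lemma riesz_leN2 x y : (- x <= - y) = (y <= x).
Proof. by rewrite -(riesz_subr_ge0 (- x)) opprK addrC riesz_subr_ge0. Qed.

Lemma riesz_leBl x y z : (x - y <= z) = (x <= z + y).
Proof. by rewrite -(riesz_leD2r y (x - y)) subrK. Qed.

Lemma riesz_addr_ge0 x y : 0 <= x -> 0 <= y -> 0 <= x + y.
Proof. by move=> x0 y0; rewrite -[leLHS]addr0 riesz_leD. Qed.

Lemma riesz_meet_lel x y : riesz_meet x y <= x.
Proof. by have /andP[] : (riesz_meet x y <= x) && (riesz_meet x y <= y) by rewrite -riesz_meetP. Qed.

Lemma riesz_meet_ler x y : riesz_meet x y <= y.
Proof. by have /andP[] : (riesz_meet x y <= x) && (riesz_meet x y <= y) by rewrite -riesz_meetP. Qed.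

Lemma riesz_join_lel x y : x <= riesz_join x y.
Proof. by have /andP[] : (x <= riesz_join x y) && (y <= riesz_join x y) by rewrite -riesz_joinP. Qed.

Lemma riesz_join_ler x y : y <= riesz_join x y.
Proof. by have /andP[] : (x <= riesz_join x y) && (y <= riesz_join x y) by rewrite -riesz_joinP. Qed.

Definition riesz_pos x : E := riesz_join x 0.

Lemma riesz_pos_ge0 x : 0 <= riesz_pos x.
Proof. exact: riesz_join_ler. Qed.

Lemma riesz_pos_ge x : x <= riesz_pos x.
Proof. exact: riesz_join_lel. Qed.

Lemma riesz_posBge0 x : 0 <= riesz_pos x - x.
Proof. by rewrite riesz_subr_ge0 riesz_pos_ge. Qed.

Lemma riesz_split x y z : 0 <= x -> 0 <= y -> 0 <= z -> z <= x + y ->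
  exists u v, [/\ 0 <= u <= x, 0 <= v <= y & z = u + v].
Proof.
move=> x0 y0 z0 zxy; exists (riesz_meet z x), (z - riesz_meet z x); split.
- by rewrite riesz_meetP z0 x0 riesz_meet_ler.
- rewrite riesz_subr_ge0 riesz_meet_lel riesz_leBl -(riesz_leD2r (- y)) addrAC subrr add0r /=.
  by rewrite riesz_meetP !riesz_leBl zxy andbT -[leLHS]addr0 riesz_leD2l.
- by rewrite addrC subrK.
Qed.

End RieszTheory.

Section RegularRiesz.
Variable R : realType.

Fact regular_riesz_lerD2r (z x y : R^o) : x <= y -> x + z <= y + z.
Proof. by move=> xy; rewrite lerD2r. Qed.

Fact regular_riesz_scaler_ge0 (a : R) (x : R^o) : 0 <= a -> 0 <= x -> 0 <= a *: x.
Proof. exact: mulr_ge0. Qed.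

Fact regular_riesz_meetP (z x y : R^o) :
  (z <= Num.min x y) = (z <= x) && (z <= y).
Proof. exact: le_min. Qed.

Fact regular_riesz_joinP (x y z : R^o) :
  (Num.max x y <= z) = (x <= z) && (y <= z).
Proof. exact: ge_max. Qed.

HB.instance Definition _ := Order.POrder.copy R^o R.
HB.instance Definition _ := POrderedLmodule_isRiesz.Build R R^o
  regular_riesz_lerD2r regular_riesz_scaler_ge0
  regular_riesz_meetP regular_riesz_joinP.

End RegularRiesz.

Section OrderDual.
Variables (R : realType) (E : rieszType R).

Definition order_dual_pred : {pred (E -> R^o)} :=
  fun f => `[< linear f /\ order_bounded f >].

Record order_dual := OrderDual {
  order_dual_fun :> E -> R^o;
  _ : order_dual_fun \in order_dual_pred }.

HB.instance Definition _ := [isSub for order_dual_fun].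
HB.instance Definition _ := [Choice of order_dual by <:].

Fact order_dual_submod_closed : submod_closed order_dual_pred.
Proof.
split.
  apply/asboolP; split=> [a x y|a b]; first by rewrite scaler0 addr0.
  by exists 0, 0 => x _; rewrite lexx.
move=> a f g /asboolP[lf bf] /asboolP[lg bg]; apply/asboolP; split.
  move=> b x y; rewrite -[LHS]/(a * f (b *: x + y) + g (b *: x + y)) lf lg.
  rewrite -[RHS]/(b * (a * f x + g x) + (a * f y + g y)).
  rewrite -[b *: f x]/(b * f x) -[b *: g x]/(b * g x) !mulrDr !mulrA.
  by rewrite [a * b]mulrC addrACA.
move=> u v; have [c [d fcd]] := bf u v; have [c' [d' gcd]] := bg u v.
exists (- (`|a| * Num.max `|c| `|d|) + c'), (`|a| * Num.max `|c| `|d| + d') => x uv.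
have /andP[g1 g2] := gcd _ uv; have /andP[f1 f2] := fcd _ uv.
have : `|a * f x| <= `|a| * Num.max `|c| `|d|.
  rewrite normrM ler_wpM2l // ler_norml; apply/andP; split.
    rewrite lerNl (@le_trans _ _ (- c)) ?lerN2 // (@le_trans _ _ `|c|) //.
      by rewrite -normrN ler_norm.
    by rewrite le_max lexx.
  by rewrite (le_trans f2)// (@le_trans _ _ `|d|) ?ler_norm// le_max lexx orbT.
by rewrite ler_norml => /andP[h1 h2]; rewrite !lerD.
Qed.
HB.instance Definition _ :=
  GRing.isSubmodClosed.Build R (E -> R^o) order_dual_pred order_dual_submod_closed.
HB.instance Definition _ := [SubChoice_isSubLmodule of order_dual by <:].

Lemma order_dual_linear (f : order_dual) : linear f.
Proof. by case: f => f /= /asboolP[]. Qed.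

Lemma order_dual_bounded (f : order_dual) : order_bounded f.
Proof. by case: f => f /= /asboolP[]. Qed.

HB.instance Definition _ (f : order_dual) :=
  GRing.isLinear.Build R E R^o *:%R f (order_dual_linear f).

Definition order_dual_of (f : E -> R^o) (lf : linear f) (bf : order_bounded f) :
  order_dual := OrderDual (asboolT (conj lf bf)).

Lemma order_dual_ext (f g : order_dual) : (forall x, f x = g x) -> f = g.
Proof. by move=> fg; apply/val_inj/funext. Qed.

Lemma order_dual_eqP (f g : order_dual) :
  (forall x, 0 <= x -> f x = g x) -> f = g.
Proof.
move=> fg; apply: order_dual_ext => x.
have [u0 v0] := (riesz_pos_ge0 x, riesz_posBge0 x).
rewrite -[x](subKr (riesz_pos x)); move: (riesz_pos x - x) v0 => v v0.
by rewrite !linearB /= !fg.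
Qed.

Lemma order_dualD (f g : order_dual) x : (f + g) x = f x + g x.
Proof. by []. Qed.
Lemma order_dualN (f : order_dual) x : (- f) x = - f x.
Proof. by []. Qed.
Lemma order_dualB (f g : order_dual) x : (f - g) x = f x - g x.
Proof. by []. Qed.
Lemma order_dualZ a (f : order_dual) x : (a *: f) x = a * f x.
Proof. by []. Qed.

Lemma positive_order_bounded (f : E -> R^o) :
  linear f -> (forall x, 0 <= x -> 0 <= f x) -> order_bounded f.
Proof.
move=> lf f0; pose lfM := GRing.isLinear.Build R E R^o *:%R f lf.
pose F : {linear E -> R^o} := HB.pack f lfM.
have mono u v : u <= v -> F u <= F v.
  by move=> uv; rewrite -subr_ge0 -linearB f0 // riesz_subr_ge0.
by move=> a b; exists (f a), (f b) => x /andP[ax xb]; rewrite !mono.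
Qed.

Definition order_dual_le (f g : order_dual) : bool :=
  `[< forall x, 0 <= x -> f x <= g x >].

Fact order_dual_le_refl : reflexive order_dual_le.
Proof. by move=> f; apply/asboolP. Qed.

Fact order_dual_le_anti : antisymmetric order_dual_le.
Proof.
move=> f g /andP[/asboolP fg /asboolP gf]; apply: order_dual_eqP => x x0.
by apply/eqP; rewrite eq_le fg // gf.
Qed.

Fact order_dual_le_trans : transitive order_dual_le.
Proof.
move=> g f h /asboolP fg /asboolP gh; apply/asboolP => x x0.
exact: le_trans (fg x x0) (gh x x0).
Qed.

HB.instance Definition _ := Order.Le_isPOrder.Build ring_display order_dual
  order_dual_le_refl order_dual_le_anti order_dual_le_trans.

Lemma order_dual_leP (f g : order_dual) :
  (f <= g) <-> (forall x, 0 <= x -> f x <= g x).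
Proof. by split=> [/asboolP|] H; [|apply/asboolP]. Qed.

(* By the Riesz-Kantorovich theorem, f^+ (x) = sup {f y | 0 <= y <= x} for
   x >= 0; the lattice operations below come from f \/ g = g + (f - g)^+ and
   f /\ g = - (- f \/ - g). *)
Section PositivePart.
Variable f : order_dual.

Let S x : set R := [set (f y : R) | y in [set y | 0 <= y <= x]].
Let p x : R := sup (S x).

Let S_sup x : 0 <= x -> has_sup (S x).
Proof.
move=> x0; split; first by exists (f 0), 0 => //=; rewrite lexx x0.
have [c [d H]] := order_dual_bounded f 0 x.
by exists d => _ [y /H/andP[_ yd] <-].
Qed.

Let p_ub x y : 0 <= y <= x -> f y <= p x.
Proof.
move=> yx; have /andP[y0 y1] := yx.
by apply: ub_le_sup; [case: (S_sup (le_trans y0 y1))|exists y].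
Qed.

Let p_le x M : 0 <= x -> (forall y, 0 <= y <= x -> f y <= M) -> p x <= M.
Proof.
move=> x0 H; apply: ge_sup; first by case: (S_sup x0).
by move=> _ [y /H yM <-].
Qed.

Let pD x y : 0 <= x -> 0 <= y -> p (x + y) = p x + p y.
Proof.
move=> x0 y0; apply/eqP; rewrite eq_le; apply/andP; split.
  apply: p_le => [|z /andP[z0 zxy]]; first exact: riesz_addr_ge0.
  have [u [v [ux vy ->]]] := riesz_split x0 y0 z0 zxy.
  by rewrite linearD lerD ?p_ub.
rewrite -lerBrDr; apply: p_le => // u /andP[u0 ux].
rewrite lerBrDr addrC -lerBrDr; apply: p_le => // v /andP[v0 vy].
rewrite lerBrDr addrC -linearD p_ub// riesz_addr_ge0//=.
exact: riesz_leD.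
Qed.

Let pZ a x : 0 <= a -> 0 <= x -> p (a *: x) = a * p x.
Proof.
have le b z : 0 < b -> 0 <= z -> p (b *: z) <= b * p z.
  move=> b0 z0; apply: p_le => [|y /andP[y0 yz]].
    by rewrite riesz_scaler_ge0// ltW.
  have -> : y = b *: (b^-1 *: y) by rewrite scalerA mulfV ?gt_eqF// scale1r.
  rewrite linearZ /= ler_pM2l// p_ub// riesz_scaler_ge0 ?invr_ge0 ?(ltW b0)//=.
  rewrite -riesz_subr_ge0 -[z]scale1r -(@mulVf _ b) ?gt_eqF// -scalerA -scalerBr.
  by rewrite riesz_scaler_ge0 ?invr_ge0 ?(ltW b0)// riesz_subr_ge0.
rewrite le_eqVlt => /predU1P[<- x0|a0 x0].
  rewrite mul0r scale0r; apply/eqP; rewrite eq_le; apply/andP; split.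
    by apply: p_le => // y /le_anti <-; rewrite linear0.
  by rewrite -(linear0 f) p_ub ?lexx.
apply/eqP; rewrite eq_le le//=.
rewrite -ler_pdivlMl// -{1}[x]scale1r -(@mulVf _ a) ?gt_eqF// -scalerA.
by rewrite le ?invr_gt0// riesz_scaler_ge0// ltW.
Qed.

Let P x : R^o := p (riesz_pos x) - p (riesz_pos x - x).

Let PE x u v : 0 <= u -> 0 <= v -> x = u - v -> P x = p u - p v.
Proof.
move=> u0 v0 xuv; have [w0 z0] := (riesz_pos_ge0 x, riesz_posBge0 x).
have H : p (riesz_pos x) + p v = p u + p (riesz_pos x - x).
  rewrite -!pD//; congr p; rewrite [in X in _ - X]xuv opprB addrCA.
  by rewrite [u + _]addrC subrK.
by apply/eqP; rewrite /P subr_eq addrAC eq_sym subr_eq H.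
Qed.

Let P_pos x : 0 <= x -> P x = p x.
Proof.
move=> x0; rewrite (@PE x x 0) ?subr0//.
by rewrite -[in p 0](scale0r 0) pZ// mul0r subr0.
Qed.

Let P_linear : linear P.
Proof.
move=> a x y.
have [xp xn] := (riesz_pos_ge0 x, riesz_posBge0 x).
have [yp yn] := (riesz_pos_ge0 y, riesz_posBge0 y).
have xE : x = riesz_pos x - (riesz_pos x - x) by rewrite subKr.
have yE : y = riesz_pos y - (riesz_pos y - y) by rewrite subKr.
move: (riesz_pos x) (riesz_pos x - x) xp xn xE => u v u0 v0 ->.
move: (riesz_pos y) (riesz_pos y - y) yp yn yE => u' v' u'0 v'0 ->.
rewrite (PE u0 v0 erefl) (PE u'0 v'0 erefl).
have [a0|/ltW a0] := lerP 0 a.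
  rewrite (@PE _ (a *: u + u') (a *: v + v')) ?riesz_addr_ge0 ?riesz_scaler_ge0//.
    rewrite !pD ?riesz_scaler_ge0// !pZ//.
    by rewrite scalerBr opprD addrACA.
  by rewrite scalerBr opprD addrACA.
have Na0 : 0 <= - a by rewrite oppr_ge0.
rewrite (@PE _ (- a *: v + u') (- a *: u + v')) ?riesz_addr_ge0 ?riesz_scaler_ge0//.
  rewrite !pD ?riesz_scaler_ge0// !pZ//.
  by rewrite !mulNr !opprD opprK addrACA [- _ + _]addrC -mulrBr.
by rewrite !scaleNr opprD opprK addrACA [- _ + _]addrC -scalerBr.
Qed.

Lemma order_dual_pos_part : exists g : order_dual,
  [/\ f <= g, 0 <= g & forall h : order_dual, f <= h -> 0 <= h -> g <= h].
Proof.
have P0 x : 0 <= x -> 0 <= P x.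
  by move=> x0; rewrite P_pos// -(linear0 f) p_ub// lexx.
exists (order_dual_of P_linear (positive_order_bounded P_linear P0)); split.
- by apply/order_dual_leP => x x0 /=; rewrite P_pos// p_ub// x0 lexx.
- by apply/order_dual_leP => x x0; exact: P0.
move=> h /order_dual_leP fh /order_dual_leP h0; apply/order_dual_leP => x x0 /=.
rewrite P_pos//; apply: p_le => // y /andP[y0 yx].
by rewrite (le_trans (fh _ y0))// -subr_ge0 -linearB h0// riesz_subr_ge0.
Qed.

End PositivePart.

Definition order_dual_pos (f : order_dual) : order_dual :=
  sval (cid (order_dual_pos_part f)).

Definition order_dual_join (f g : order_dual) : order_dual :=
  g + order_dual_pos (f - g).

Definition order_dual_meet (f g : order_dual) : order_dual :=
  - order_dual_join (- f) (- g).

Fact order_dual_lerD2r (h f g : order_dual) : f <= g -> f + h <= g + h.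
Proof.
move=> /order_dual_leP fg; apply/order_dual_leP => x x0.
by rewrite !order_dualD lerD2r fg.
Qed.

Fact order_dual_scaler_ge0 (a : R) (f : order_dual) : 0 <= a -> 0 <= f -> 0 <= a *: f.
Proof.
move=> a0 /order_dual_leP f0; apply/order_dual_leP => x x0.
by rewrite mulr_ge0// f0.
Qed.

Let dual_leD2r (h f g : order_dual) : (f + h <= g + h) = (f <= g).
Proof.
apply/idP/idP; last exact: order_dual_lerD2r.
by move=> /(order_dual_lerD2r (- h)); rewrite !addrK.
Qed.

Let dual_leN2 (f g : order_dual) : (- f <= - g) = (g <= f).
Proof. by rewrite -(dual_leD2r (f + g) (- f)) addKr addrCA addNr addr0. Qed.

Fact order_dual_joinP (f g h : order_dual) :
  (order_dual_join f g <= h) = (f <= h) && (g <= h).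
Proof.
rewrite /order_dual_join /order_dual_pos; case: cid => k /= [fk k0 kmin].
have gk : g <= g + k by rewrite -{1}[g]add0r [g + k]addrC dual_leD2r.
apply/idP/andP => [gkh|[fh gh]].
  split; last exact: le_trans gkh.
  by rewrite (le_trans _ gkh)// -[leLHS](subrK g) [leRHS]addrC dual_leD2r.
rewrite -(subrK g h) addrC dual_leD2r; apply: kmin.
  by rewrite dual_leD2r.
by rewrite -(dual_leD2r g) add0r subrK.
Qed.

Fact order_dual_meetP (h f g : order_dual) :
  (h <= order_dual_meet f g) = (h <= f) && (h <= g).
Proof.
by rewrite -dual_leN2 /order_dual_meet opprK order_dual_joinP !dual_leN2.
Qed.

HB.instance Definition _ := POrderedLmodule_isRiesz.Build R order_dual
  order_dual_lerD2r order_dual_scaler_ge0 order_dual_meetP order_dual_joinP.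

Lemma order_dual_ge0P (f : order_dual) : (0 <= f) <-> (forall x, 0 <= x -> 0 <= f x).
Proof. exact: order_dual_leP. Qed.

End OrderDual.

Definition order_bidual (R : realType) (E : rieszType R) : rieszType R :=
  order_dual (order_dual E : rieszType R).

Section OrderContinuous.
Variable R : realType.

Definition directed (I : Type) (r : I -> I -> Prop) : Prop :=
  [/\ inhabited I, forall i, r i i, forall i j k, r i j -> r j k -> r i k
    & forall i j, exists k, r i k /\ r j k].

Definition net_decr0 (G : rieszType R) (I : Type) (r : I -> I -> Prop)
    (y : I -> G) : Prop :=
  [/\ forall i j, r i j -> y j <= y i, forall i, 0 <= y i
    & forall z, (forall i, z <= y i) -> z <= 0].

(* The dominating net has the same index set as the convergent one. For order
   bounded functionals, allowing another index set gives the same order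
   continuous ones. *)
Definition order_cvg (G : rieszType R) (I : Type) (r : I -> I -> Prop)
    (x : I -> G) (l : G) : Prop :=
  exists2 y : I -> G, net_decr0 r y & forall i, riesz_abs (x i - l) <= y i.

Definition order_continuous (G H : rieszType R) (f : G -> H) : Prop :=
  forall (I : Type) (r : I -> I -> Prop) (x : I -> G), directed r ->
    order_cvg r x 0 -> order_cvg r (fun i => f (x i)) 0.

Definition order_continuous_dual (G : rieszType R) : set (order_dual G) :=
  [set f | order_continuous (f : G -> R^o)].

End OrderContinuous.

Section Multilinear.
Variables (R : realType) (m : nat) (E : 'I_m -> rieszType R) (F : rieszType R).

(* [dfwith x t] is the family [x] with its [j]-th entry replaced by [t : E j]. *)
Definition multilinear (A : (forall i, E i) -> F) : Prop :=
  forall (x : forall i, E i) (j : 'I_m), linear (fun t : E j => A (dfwith x t)).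

Definition positive_operator (A : (forall i, E i) -> F) : Prop :=
  forall x : forall i, E i, (forall i, 0 <= x i) -> 0 <= A x.

Definition regular_operator (A : (forall i, E i) -> F) : Prop :=
  exists P Q : (forall i, E i) -> F,
    [/\ multilinear P, positive_operator P, multilinear Q, positive_operator Q
      & forall x, A x = P x - Q x].

Record regular_op := RegularOp {
  regular_op_fun :> (forall i, E i) -> F;
  regular_opP : regular_operator regular_op_fun }.

(* Only stated for regular operators, which are order bounded. When every [S i]
   is an ideal of [E i], as is the band of order continuous functionals,
   disjointness in [S i] is disjointness in [E i], so that this says that the
   restriction of [A] to the product of the [S i] is disjointness preserving. *)
Definition disjointness_preserving_on (S : forall i, set (E i)) (A : regular_op) : Prop :=
  forall (j : 'I_m) (x : forall i, E i), (forall i, i != j -> S i (x i)) ->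
  forall u v : E j, S j u -> S j v -> riesz_disjoint u v ->
    riesz_disjoint (A (dfwith x u)) (A (dfwith x v)).

Definition disjointness_preserving (A : regular_op) : Prop :=
  disjointness_preserving_on (fun=> setT) A.

Lemma multilinear_lin (A B : (forall i, E i) -> F) (a : R) :
  multilinear A -> multilinear B -> multilinear (fun x => a *: A x + B x).
Proof.
move=> mA mB x j b s t /=; rewrite mA mB !scalerDr !scalerA [b * a]mulrC.
by rewrite addrACA.
Qed.

Lemma multilinear0 : multilinear (fun=> 0).
Proof. by move=> x j b s t /=; rewrite scaler0 addr0. Qed.

Lemma multilinearD (A B : (forall i, E i) -> F) :
  multilinear A -> multilinear B -> multilinear (fun x => A x + B x).
Proof.
move=> mA mB; have := multilinear_lin 1 mA mB.
by congr multilinear; apply/funext => x; rewrite scale1r.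
Qed.

Lemma regular_multilinear (A : (forall i, E i) -> F) :
  regular_operator A -> multilinear A.
Proof.
move=> [P [Q [mP _ mQ _ AE]]]; have := multilinear_lin (-1) mQ mP.
by congr multilinear; apply/funext => x; rewrite AE scaleN1r addrC.
Qed.

Lemma positive_regular (A : (forall i, E i) -> F) :
  multilinear A -> positive_operator A -> regular_operator A.
Proof.
move=> mA pA; exists A, (fun=> 0); split=> //; first exact: multilinear0.
by move=> x; rewrite subr0.
Qed.

Lemma regular_op_ext (A B : regular_op) : (forall x, A x = B x) -> A = B.
Proof.
case: A B => [A rA] [B rB] /= /funext AB; rewrite AB in rA *.
by congr RegularOp; exact: Prop_irrelevance.
Qed.

Lemma regular_op_decomp (A : regular_op) : exists P Q : regular_op,
  [/\ positive_operator P, positive_operator Q & forall x, A x = P x - Q x].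
Proof.
have [P [Q [mP pP mQ pQ AE]]] := regular_opP A.
by exists (RegularOp (positive_regular mP pP)), (RegularOp (positive_regular mQ pQ)).
Qed.

End Multilinear.

Definition regular_form (R : realType) (m : nat) (E : 'I_m -> rieszType R) : Type :=
  @regular_op R m E R^o.

Section Tuples.
Variable R : realType.

Definition tcons (n : nat) (E : 'I_n.+1 -> rieszType R) (t : E ord0)
    (y : forall i : 'I_n, E (lift ord0 i)) : forall i, E i :=
  fun i => match unliftP ord0 i with
  | UnliftSome j e => ecast k (E k) (esym e) (y j)
  | UnliftNone e => ecast k (E k) (esym e) t
  end.

Lemma tcons0 n (E : 'I_n.+1 -> rieszType R) t y : @tcons n E t y ord0 = t.
Proof.
rewrite /tcons; case: unliftP => [j e|e]; last by rewrite eq_axiomK.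
by exfalso; move: (neq_lift ord0 j); rewrite -e eqxx.
Qed.

Lemma tconsS n (E : 'I_n.+1 -> rieszType R) t y j :
  @tcons n E t y (lift ord0 j) = y j.
Proof.
rewrite /tcons; case: unliftP => [k e|e]; last first.
  by exfalso; move: (neq_lift ord0 j); rewrite e eqxx.
by have jk := lift_inj e; subst k; rewrite eq_axiomK.
Qed.

Lemma tcons_ext n (E : 'I_n.+1 -> rieszType R) (x z : forall i, E i) :
  x ord0 = z ord0 -> (forall j, x (lift ord0 j) = z (lift ord0 j)) -> x = z.
Proof.
by move=> x0 xS; apply: functional_extensionality_dep => i; case: (unliftP ord0 i) => [j|] ->.
Qed.

Lemma dfwith_tcons0 n (E : 'I_n.+1 -> rieszType R) t y (u : E ord0) :
  dfwith (@tcons n E t y) u = tcons u y.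
Proof.
apply: tcons_ext => [|j]; first by rewrite dfwith_in tcons0.
by rewrite dfwith_out ?neq_lift// !tconsS.
Qed.

Lemma dfwith_tconsS n (E : 'I_n.+1 -> rieszType R) t y j (u : E (lift ord0 j)) :
  dfwith (@tcons n E t y) u = tcons t (dfwith (T := fun i => E (lift ord0 i)) y u).
Proof.
apply: tcons_ext => [|k]; first by rewrite dfwith_out 1?eq_sym ?neq_lift// !tcons0.
rewrite tconsS; case: (eqVneq j k) => [e|jk].
  by subst k; rewrite !dfwith_in.
by rewrite !dfwith_out ?tconsS// (inj_eq lift_inj).
Qed.

Lemma dfwith_lift n (E : 'I_n.+1 -> rieszType R) (x : forall i, E i) j
    (u : E (lift ord0 j)) :
  (fun i => dfwith x u (lift ord0 i)) =
  dfwith (T := fun i => E (lift ord0 i)) (fun i => x (lift ord0 i)) u.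
Proof.
apply: functional_extensionality_dep => k; case: (eqVneq j k) => [e|jk].
  by subst k; rewrite !dfwith_in.
by rewrite !dfwith_out// (inj_eq lift_inj).
Qed.

Lemma dfwith_lift0 n (E : 'I_n.+1 -> rieszType R) (x : forall i, E i) (u : E ord0) :
  (fun i => dfwith x u (lift ord0 i)) = (fun i => x (lift ord0 i)).
Proof.
by apply: functional_extensionality_dep => k; rewrite dfwith_out// neq_lift.
Qed.

Lemma tcons_ge0 n (E : 'I_n.+1 -> rieszType R) t y :
  0 <= t -> (forall i, 0 <= y i) -> forall i, 0 <= @tcons n E t y i.
Proof.
by move=> t0 y0 i; case: (unliftP ord0 i) => [j|] ->; rewrite ?tcons0 ?tconsS.
Qed.

End Tuples.

Section Curry.
Variables (R : realType) (n : nat) (E : 'I_n.+1 -> rieszType R).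
Let E' (i : 'I_n) : rieszType R := E (lift ord0 i).

Lemma tcons_linear (B : regular_form E) (y : forall i, E' i) :
  linear (fun t => B (tcons t y) : R^o).
Proof.
move=> a s t; have := regular_multilinear (regular_opP B) (tcons 0 y) (j := ord0) a s t.
by rewrite /= !dfwith_tcons0.
Qed.

Lemma tcons_order_bounded (B : regular_form E) (y : forall i, E' i) :
  order_bounded (fun t => B (tcons t y) : R^o).
Proof.
have [P [Q [pP pQ BE]]] := regular_op_decomp B.
suff bnd (A : regular_form E) : positive_operator A ->
    order_bounded (fun t => A (tcons t y) : R^o).
  pose f := order_dual_of (tcons_linear P y) (bnd P pP).
  pose g := order_dual_of (tcons_linear Q y) (bnd Q pQ).
  have := order_dual_bounded (f - g).
  by congr order_bounded; apply/funext => t; rewrite order_dualB BE.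
move=> pA; suff H k (z : forall i, E' i) : (forall i : 'I_n, (k <= i)%N -> 0 <= z i) ->
    order_bounded (fun t => A (tcons t z) : R^o).
  by apply: (H n) => i; rewrite leqNgt ltn_ord.
elim: k z => [|k IH] z z0.
  apply: (positive_order_bounded (tcons_linear A z)) => t t0.
  by apply: pA; apply: tcons_ge0 => // i; exact: z0.
have [kn|nk] := ltnP k n; last first.
  by apply: IH => i ki; have := leq_trans nk ki; rewrite leqNgt ltn_ord.
pose o := Ordinal kn.
have zw (w : E' o) : 0 <= w -> forall i : 'I_n, (k <= i)%N -> 0 <= dfwith z w i.
  move=> w0 i ki; case: (eqVneq o i) => [<-|oi]; first by rewrite dfwith_in.
  rewrite dfwith_out// z0// ltn_neqAle ki andbT.
  by apply: contra oi => /eqP e; apply/eqP/val_inj.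
pose u := riesz_pos (z o); pose v := riesz_pos (z o) - z o.
pose f := order_dual_of (tcons_linear A _) (IH _ (zw u (riesz_pos_ge0 _))).
pose g := order_dual_of (tcons_linear A _) (IH _ (zw v (riesz_posBge0 _))).
have := order_dual_bounded (f - g).
congr order_bounded; apply/funext => t; rewrite order_dualB /=.
rewrite -!dfwith_tconsS.
have := regular_multilinear (regular_opP A) (tcons t z) (j := lift ord0 o) (-1) v u.
rewrite /= !scaleN1r addrC => <-; congr (A _).
rewrite dfwith_tconsS; congr tcons.
apply: functional_extensionality_dep => i.
case: (eqVneq o i) => [<-|oi]; first by rewrite dfwith_in opprB subrK.
by rewrite dfwith_out.
Qed.

Definition form_curry (B : regular_form E) (y : forall i, E' i) : order_dual (E ord0) :=
  order_dual_of (tcons_linear B y) (tcons_order_bounded B y).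

Lemma form_curryE B y t : form_curry B y t = B (tcons t y).
Proof. by []. Qed.

Lemma form_curry_multilinear (B : regular_form E) (x : order_bidual (E ord0)) :
  multilinear (fun y => x (form_curry B y) : R^o).
Proof.
move=> y j a s t /=; rewrite -linearP; congr (x _).
apply: order_dual_ext => r.
have := regular_multilinear (regular_opP B) (tcons r y) (j := lift ord0 j) a s t.
by rewrite /= !dfwith_tconsS.
Qed.

Lemma form_curry_positive (B : regular_form E) (x : order_bidual (E ord0)) :
  0 <= x -> positive_operator B -> positive_operator (fun y => x (form_curry B y) : R^o).
Proof.
move=> /order_dual_ge0P x0 pB y y0; apply: x0; apply/order_dual_ge0P => t t0.
by apply: pB; exact: tcons_ge0.
Qed.

Lemma form_curry_regular (B : regular_form E) (x : order_bidual (E ord0)) :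
  regular_operator (fun y => x (form_curry B y) : R^o).
Proof.
have [P [Q [pP pQ BE]]] := regular_op_decomp B.
have [u0 v0] := (riesz_pos_ge0 x, riesz_posBge0 x).
have xE : x = riesz_pos x - (riesz_pos x - x) by rewrite subKr.
move: (riesz_pos x) (riesz_pos x - x) u0 v0 xE => u v u0 v0 xE.
exists (fun y => (u (form_curry P y) : R^o) + v (form_curry Q y)).
exists (fun y => (u (form_curry Q y) : R^o) + v (form_curry P y)); split.
- by apply: multilinearD; exact: form_curry_multilinear.
- move=> y y0; apply: (@addr_ge0 R).
    exact: (form_curry_positive u0 pP).
  exact: (form_curry_positive v0 pQ).
- by apply: multilinearD; exact: form_curry_multilinear.
- move=> y y0; apply: (@addr_ge0 R).
    exact: (form_curry_positive u0 pQ).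
  exact: (form_curry_positive v0 pP).
move=> y; have -> : form_curry B y = form_curry P y - form_curry Q y.
  by apply: order_dual_ext => t; rewrite order_dualB !form_curryE BE.
rewrite linearB xE; move: (form_curry P y) (form_curry Q y) => p q.
rewrite -[LHS]/(u p - v p - (u q - v q)); move: (u p) (u q) (v p) (v q) => a b c d.
by rewrite opprB [- (b + c)]opprD addrACA [- c - b]addrC.
Qed.

Definition bidual_bar (x : order_bidual (E ord0)) (B : regular_form E) : regular_form E' :=
  RegularOp (form_curry_regular B x).

End Curry.

Section Arens.
Variable R : realType.

(* The composition of the operators [bidual_bar (x i)], the first one being
   applied first. The recursion goes down to forms on the empty product, which
   are just real numbers, so that its last step maps a form [B] in one variable
   to the image of [B] under the bidual element. *)
Fixpoint bidual_bars (n : nat) : forall E : 'I_n -> rieszType R,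
    (forall i, order_bidual (E i)) -> regular_form E -> R :=
  match n with
  | 0 => fun E _ B => B (fun i : 'I_0 => False_rect _ (notF (ltn_ord i)))
  | n'.+1 => fun E x B =>
      @bidual_bars n' (fun i => E (lift ord0 i)) (fun i => x (lift ord0 i))
        (bidual_bar (x ord0) B)
  end.

Definition form_linear n (E : 'I_n -> rieszType R) (p : regular_form E -> R) : Prop :=
  forall a (B B1 B2 : regular_form E), (forall x, B x = a *: B1 x + B2 x) ->
    p B = a * p B1 + p B2.

Definition form_positive n (E : 'I_n -> rieszType R) (p : regular_form E -> R) : Prop :=
  forall B : regular_form E, positive_operator B -> 0 <= p B.

Lemma bidual_bar_linear n (E : 'I_n.+1 -> rieszType R) (x : order_bidual (E ord0))
    a (B B1 B2 : regular_form E) : (forall y, B y = a *: B1 y + B2 y) ->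
  forall y, bidual_bar x B y = a *: bidual_bar x B1 y + bidual_bar x B2 y.
Proof.
move=> BE y /=; rewrite -linearP; congr (x _).
by apply: order_dual_ext => t; rewrite [LHS]BE.
Qed.

Lemma bidual_bars_linear n (E : 'I_n -> rieszType R) (x : forall i, order_bidual (E i)) :
  form_linear (bidual_bars x).
Proof.
elim: n => [|n IH] in E x * => a B B1 B2 BE; first exact: BE.
by apply: IH; exact: bidual_bar_linear.
Qed.

Lemma bidual_bars_positive n (E : 'I_n -> rieszType R) (x : forall i, order_bidual (E i)) :
  (forall i, 0 <= x i) -> form_positive (bidual_bars x).
Proof.
elim: n => [|n IH] in E x * => x0 B pB; first by apply: pB => -[].
by apply: IH => //; exact: form_curry_positive.
Qed.

Lemma bidual_bars_multilinear n (E : 'I_n -> rieszType R) (B : regular_form E) :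
  multilinear (E := fun i => order_bidual (E i)) (F := R^o) (fun x => bidual_bars x B).
Proof.
elim: n => [|n IH] in E B * => x j a s t; first by case: (notF (ltn_ord j)).
rewrite /=; case: (unliftP ord0 j) => [k|] jE; subst j.
  rewrite !dfwith_out ?[lift _ _ == _]eq_sym ?neq_lift//.
  rewrite !(dfwith_lift (E := fun i => order_bidual (E i))).
  exact: (IH _ _ _ k a s t).
rewrite !dfwith_in !(dfwith_lift0 (E := fun i => order_bidual (E i))).
exact: bidual_bars_linear.
Qed.

Lemma bidual_bars_decomp n (E : 'I_n -> rieszType R) (x : forall i, order_bidual (E i)) :
  exists p q : regular_form E -> R,
    [/\ form_linear p, form_positive p, form_linear q, form_positive q
      & forall B, bidual_bars x B = p B - q B].
Proof.
elim: n => [|n IH] in E x *.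
  exists (bidual_bars x), (fun=> 0); split=> //.
  - exact: bidual_bars_linear.
  - by apply: bidual_bars_positive => -[].
  - by move=> a *; rewrite mulr0 addr0.
  - by move=> B; rewrite subr0.
have [p [q [lp pp lq pq xE]]] := IH _ (fun i => x (lift ord0 i)).
have [u0 v0] := (riesz_pos_ge0 (x ord0), riesz_posBge0 (x ord0)).
have x0E : x ord0 = riesz_pos (x ord0) - (riesz_pos (x ord0) - x ord0) by rewrite subKr.
move: (riesz_pos (x ord0)) (riesz_pos (x ord0) - x ord0) u0 v0 x0E => u v u0 v0 x0E.
have lin r s (w z : order_bidual (E ord0)) : form_linear r -> form_linear s ->
    form_linear (fun B => r (bidual_bar w B) + s (bidual_bar z B)).
  move=> lr ls a B B1 B2 BE.
  rewrite (lr a _ _ _ (bidual_bar_linear w BE)) (ls a _ _ _ (bidual_bar_linear z BE)).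
  by rewrite mulrDr addrACA.
have pos r s (w z : order_bidual (E ord0)) : form_positive r -> form_positive s ->
    0 <= w -> 0 <= z ->
    form_positive (fun B => r (bidual_bar w B) + s (bidual_bar z B)).
  move=> pr ps w0 z0 B pB; apply: addr_ge0.
    by apply: pr; exact: form_curry_positive.
  by apply: ps; exact: form_curry_positive.
exists (fun B => p (bidual_bar u B) + q (bidual_bar v B)).
exists (fun B => q (bidual_bar u B) + p (bidual_bar v B)).
split; [exact: lin|exact: pos|exact: lin|exact: pos|move=> B].
have barE y : bidual_bar (x ord0) B y =
    (-1) *: bidual_bar v B y + bidual_bar u B y.
  by rewrite /= x0E scaleN1r addrC.
rewrite [LHS]xE (lp _ _ _ _ barE) (lq _ _ _ _ barE) !mulN1r.
move: (p _) (p _) (q _) (q _) => a b c d.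
by rewrite [- d + c]addrC opprB opprD [- b + a]addrC addrACA [- b - c]addrC.
Qed.

Section Permutation.
Variables (m : nat) (E : 'I_m -> rieszType R) (rho : 'S_m).

(* The family [(x_(rho^-1(1)), ..., x_(rho^-1(m)))], where [x_i] is in
   [E_(rho(i))]. *)
Definition perm_family (x : forall i, E (rho i)) : forall i, E i :=
  fun i => ecast j (E j) (permKV rho i) (x ((rho^-1)%g i)).

Lemma perm_familyE x k : perm_family x (rho k) = x k.
Proof.
rewrite /perm_family; move: (permKV _ _) => e.
by have lk := permK rho k; move: ((rho^-1)%g _) lk e => l -> e; rewrite eq_axiomK.
Qed.

Lemma perm_family_dfwith x j (t : E (rho j)) :
  perm_family (dfwith (T := fun i => E (rho i)) x t) = dfwith (perm_family x) t.
Proof.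
apply: functional_extensionality_dep => i.
rewrite -[i](permKV rho); move: ((rho^-1)%g i) => k; rewrite perm_familyE.
case: (eqVneq j k) => [<-|jk]; first by rewrite !dfwith_in.
by rewrite !dfwith_out ?perm_familyE// (inj_eq perm_inj).
Qed.

Lemma perm_family_ge0 x : (forall i, 0 <= x i) -> forall i, 0 <= perm_family x i.
Proof. by move=> x0 i; rewrite -[i](permKV rho) perm_familyE. Qed.

Lemma perm_multilinear (F : rieszType R) (C : (forall i, E i) -> F) :
  multilinear C -> multilinear (fun x => C (perm_family x)).
Proof.
by move=> mC x j a s t; rewrite /= !perm_family_dfwith; exact: mC.
Qed.

Lemma perm_form_regular (C : regular_form E) :
  regular_operator (fun x => C (perm_family x)).
Proof.
have [P [Q [mP pP mQ pQ CE]]] := regular_opP C.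
exists (fun x => P (perm_family x)), (fun x => Q (perm_family x)); split=> //.
- exact: perm_multilinear.
- by move=> x x0; apply: pP; exact: perm_family_ge0.
- exact: perm_multilinear.
- by move=> x x0; apply: pQ; exact: perm_family_ge0.
Qed.

Definition perm_form (C : regular_form E) : regular_form (fun i => E (rho i)) :=
  RegularOp (perm_form_regular C).

End Permutation.

Section Composition.
Variables (m : nat) (E : 'I_m -> rieszType R) (F : rieszType R).
Implicit Types (y : order_dual F) (A : regular_op E F).

Lemma comp_form_multilinear y A : multilinear (fun x => y (A x) : R^o).
Proof.
move=> x j a s t /=; rewrite -linearP; congr (y _).
exact: regular_multilinear (regular_opP A) _ _ _ _ _.
Qed.

Lemma comp_form_positive y A : 0 <= y -> positive_operator A ->
  positive_operator (fun x => y (A x) : R^o).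
Proof. by move=> /order_dual_ge0P y0 pA x x0; apply: y0; exact: pA. Qed.

Lemma comp_form_regular y A : regular_operator (fun x => y (A x) : R^o).
Proof.
have [P [Q [pP pQ AE]]] := regular_op_decomp A.
have [u0 v0] := (riesz_pos_ge0 y, riesz_posBge0 y).
have yE : y = riesz_pos y - (riesz_pos y - y) by rewrite subKr.
move: (riesz_pos y) (riesz_pos y - y) u0 v0 yE => u v u0 v0 yE.
exists (fun x => (u (P x) : R^o) + v (Q x)), (fun x => (u (Q x) : R^o) + v (P x)); split.
- by apply: multilinearD; exact: comp_form_multilinear.
- by move=> x x0; apply: (@addr_ge0 R); apply: comp_form_positive x0.
- by apply: multilinearD; exact: comp_form_multilinear.
- by move=> x x0; apply: (@addr_ge0 R); apply: comp_form_positive x0.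
move=> x; rewrite AE linearB yE; move: (P x) (Q x) => p q.
rewrite -[LHS]/(u p - v p - (u q - v q)); move: (u p) (u q) (v p) (v q) => a b c d.
by rewrite opprB [- (b + c)]opprD addrACA [- c - b]addrC.
Qed.

Definition comp_form (y : order_dual F) (A : regular_op E F) : regular_form E :=
  RegularOp (comp_form_regular y A).

End Composition.

Section ArensExtension.
Variables (m : nat) (E : 'I_m -> rieszType R) (F : rieszType R) (rho : 'S_m).

Definition arens_value (A : regular_op E F) (x : forall i, order_bidual (E i))
    (y : order_dual F) : R^o :=
  bidual_bars (fun i => x (rho i)) (perm_form rho (comp_form y A)).

Lemma comp_perm_linear (A : regular_op E F) (p : regular_form (fun i => E (rho i)) -> R) :
  form_linear p -> linear (fun y => p (perm_form rho (comp_form y A)) : R^o).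
Proof. by move=> lp a y z; apply: lp. Qed.

Lemma comp_perm_positive (A : regular_op E F) (p : regular_form (fun i => E (rho i)) -> R) :
  form_positive p -> positive_operator A ->
  forall y, 0 <= y -> 0 <= p (perm_form rho (comp_form y A)).
Proof.
move=> pp pA y y0; apply: pp => x x0.
by apply: (comp_form_positive y0 pA); exact: perm_family_ge0.
Qed.

Lemma arens_value_linear (A : regular_op E F) (x : forall i, order_bidual (E i)) :
  linear (arens_value A x).
Proof. exact: comp_perm_linear (bidual_bars_linear _). Qed.

Lemma arens_value_sub (A P Q : regular_op E F) x y :
  (forall z, A z = P z - Q z) ->
  arens_value A x y = arens_value P x y - arens_value Q x y.
Proof.
move=> AE; rewrite /arens_value (bidual_bars_linear _ (a := -1)
  (B1 := perm_form rho (comp_form y Q)) (B2 := perm_form rho (comp_form y P))).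
  by rewrite mulN1r addrC.
by move=> z /=; rewrite AE linearB /= scaleN1r addrC.
Qed.

Lemma arens_value_bounded (A : regular_op E F) (x : forall i, order_bidual (E i)) :
  order_bounded (arens_value A x).
Proof.
suff bnd (B : regular_op E F) : positive_operator B -> order_bounded (arens_value B x).
  have [P [Q [pP pQ AE]]] := regular_op_decomp A.
  pose f := order_dual_of (arens_value_linear P x) (bnd P pP).
  pose g := order_dual_of (arens_value_linear Q x) (bnd Q pQ).
  have := order_dual_bounded (f - g).
  by congr order_bounded; apply/funext => y; rewrite (arens_value_sub _ _ AE).
move=> pB.
have [p [q [lp pp lq pq xE]]] := bidual_bars_decomp (fun i => x (rho i)).
pose f := order_dual_of (comp_perm_linear B lp)
  (positive_order_bounded (comp_perm_linear B lp) (comp_perm_positive pp pB)).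
pose g := order_dual_of (comp_perm_linear B lq)
  (positive_order_bounded (comp_perm_linear B lq) (comp_perm_positive pq pB)).
have := order_dual_bounded (f - g).
by congr order_bounded; apply/funext => y; rewrite /arens_value xE.
Qed.

Definition arens_fun (A : regular_op E F) (x : forall i, order_bidual (E i)) :
  order_bidual F := order_dual_of (arens_value_linear A x) (arens_value_bounded A x).

Lemma arens_fun_multilinear (A : regular_op E F) : multilinear (arens_fun A).
Proof.
pose G i : rieszType R := order_bidual (E i).
move=> x j a s t; apply: order_dual_ext => y.
have [k jE] : exists k, j = rho k by exists ((rho^-1)%g j); rewrite permKV.
subst j; have dE (w : G (rho k)) :
    (fun i => dfwith x w (rho i)) = dfwith (T := fun i => G (rho i)) (fun i => x (rho i)) w.
  apply: functional_extensionality_dep => i; case: (eqVneq k i) => [<-|ki].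
    by rewrite !dfwith_in.
  by rewrite !dfwith_out// (inj_eq perm_inj).
have := bidual_bars_multilinear (perm_form rho (comp_form y A))
  (fun i => x (rho i)) (j := k) a s t.
by rewrite /= -!dE.
Qed.

Lemma arens_fun_positive (A : regular_op E F) :
  positive_operator A -> positive_operator (arens_fun A).
Proof.
move=> pA x x0; apply/order_dual_ge0P => y y0.
by apply: comp_perm_positive y0 => //; exact: bidual_bars_positive.
Qed.

Lemma arens_fun_regular (A : regular_op E F) : regular_operator (arens_fun A).
Proof.
have [P [Q [pP pQ AE]]] := regular_op_decomp A.
exists (arens_fun P), (arens_fun Q); split.
- exact: arens_fun_multilinear.
- exact: arens_fun_positive.
- exact: arens_fun_multilinear.
- exact: arens_fun_positive.
by move=> x; apply: order_dual_ext => y; exact: arens_value_sub.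
Qed.

Definition arens_extension (A : regular_op E F) :
    regular_op (fun i => order_bidual (E i)) (order_bidual F) :=
  RegularOp (arens_fun_regular A).

End ArensExtension.
End Arens.

(* Main.v *)
(* Write [J] for the evaluation embedding of [E] into its bidual. On arguments
   from the images of [J] the Arens extension is [A] itself, so it suffices to
   approximate. For every [f >= 0], an order continuous [w] on the order dual is
   a limit of elements [J y] in the seminorm given by the value of the modulus
   at [f]: it is absolutely continuous with respect to evaluations, hence up to
   a small error dominated by some [J a], and a [w] between [0] and [J a] is a
   limit of combinations of near-components of [J a], each of which is close to
   an element of [J E] (by the Riesz-Kantorovich formula, applied once in each
   dual). If [u] and [v] are disjoint, their approximants can be trimmed to be
   disjoint in [E]. Replacing the arguments of the Arens extension one at a
   time, from the last to the first, reduces its values at the functionals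
   dominated by a given one to values of [A], up to a small error. *)
Require Import Defs.
From HB Require Import structures.
From mathcomp Require Import all_boot all_order all_algebra all_fingroup.
From mathcomp Require Import boolp classical_sets functions reals.
From mathcomp Require Import lra.

Set Implicit Arguments.
Unset Strict Implicit.
Unset Printing Implicit Defensive.

Import Order.TTheory GRing.Theory Num.Theory.
Local Open Scope ring_scope.

(** * Moduli, decomposition and disjointness in a Riesz space *)

Section RieszFacts.
Variables (R : realType) (E : rieszType R).
Implicit Types x y z a b c : E.

Lemma riesz_abs_leP x y : riesz_abs x <= y <-> x <= y /\ - x <= y.
Proof. by rewrite /riesz_abs riesz_joinP; split=> [/andP|[-> ->]]. Qed.

Lemma riesz_half_ge0 x : 0 <= x + x -> 0 <= x.
Proof.
move=> x0; have -> : x = 2^-1 *: (x + x).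
  by rewrite -mulr2n -scaler_nat scalerA mulVf ?scale1r// pnatr_eq0.
by rewrite riesz_scaler_ge0// invr_ge0.
Qed.

Lemma riesz_le_double x y : x + x <= y + y -> x <= y.
Proof.
by move=> xy; rewrite -riesz_subr_ge0; apply: riesz_half_ge0; rewrite addrACA -opprD riesz_subr_ge0.
Qed.

Lemma riesz_abs_dom_ge0 x y : riesz_abs x <= y -> 0 <= y.
Proof.
move=> /riesz_abs_leP[xy xy']; apply: riesz_half_ge0.
by rewrite -(subrr x) riesz_leD.
Qed.

Lemma riesz_abs_ge0 x : 0 <= riesz_abs x.
Proof. exact: (@riesz_abs_dom_ge0 x _ (lexx _)). Qed.

Lemma riesz_abs_ge x : x <= riesz_abs x.
Proof. exact: riesz_join_lel. Qed.

Lemma riesz_abs_geN x : - x <= riesz_abs x.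
Proof. exact: riesz_join_ler. Qed.

Lemma riesz_ge0_abs x : 0 <= x -> riesz_abs x = x.
Proof.
move=> x0; apply/le_anti; rewrite riesz_abs_ge andbT.
by apply/riesz_abs_leP; split=> //; apply: (le_trans _ x0); rewrite riesz_oppr_le0.
Qed.

Lemma riesz_absN x : riesz_abs (- x) = riesz_abs x.
Proof.
have le (y : E) : riesz_abs (- y) <= riesz_abs y.
  by apply/riesz_abs_leP; rewrite opprK riesz_abs_ge riesz_abs_geN.
by apply/le_anti; rewrite le -{1}[x]opprK le.
Qed.

Lemma riesz_absD x y : riesz_abs (x + y) <= riesz_abs x + riesz_abs y.
Proof.
apply/riesz_abs_leP; rewrite opprD.
by split; apply: riesz_leD; rewrite ?riesz_abs_ge ?riesz_abs_geN.
Qed.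

Lemma riesz_absD_le x y b c :
  riesz_abs x <= b -> riesz_abs y <= c -> riesz_abs (x + y) <= b + c.
Proof. by move=> xb yc; apply: le_trans (riesz_absD _ _) (riesz_leD xb yc). Qed.

Lemma riesz_abs_pos x : riesz_abs x = riesz_pos x + (riesz_pos x - x).
Proof.
apply/le_anti/andP; split.
  have [p0 q0] := (riesz_pos_ge0 x, riesz_posBge0 x).
  apply/riesz_abs_leP; split; last by rewrite addrA -[leLHS]add0r riesz_leD2r riesz_addr_ge0.
  by rewrite -[leLHS]addr0 riesz_leD// riesz_pos_ge.
(* Half of [|x| + x] is an upper bound of both [x] and [0], hence dominates the positive part. *)
have [s sE] : exists s, s + s = riesz_abs x + x.
  exists (2^-1 *: (riesz_abs x + x)).
  by rewrite -mulr2n -scaler_nat scalerA mulfV ?scale1r// pnatr_eq0.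
have ps : riesz_pos x <= s.
  rewrite /riesz_pos riesz_joinP; apply/andP; split; last first.
    by apply: riesz_half_ge0; rewrite sE -[X in _ + X]opprK riesz_subr_ge0 riesz_abs_geN.
  rewrite -riesz_subr_ge0; apply: riesz_half_ge0.
  by rewrite addrACA sE -opprD riesz_subr_ge0 riesz_leD2r riesz_abs_ge.
by rewrite addrA riesz_leBl -sE riesz_leD.
Qed.

Lemma riesz_abs_sub_le x y : 0 <= x -> x <= y + y -> riesz_abs (x - y) <= y.
Proof.
move=> x0 xy; apply/riesz_abs_leP; rewrite riesz_leBl opprB riesz_leBl; split=> //.
by rewrite -[leLHS]addr0 riesz_leD2l.
Qed.

(** Shifting [a] by [b + c] gives a vector between [0] and [2 b + 2 c]; its positive decomposition,
    shifted back by [b] and [c], is the signed one. *)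
Lemma riesz_signed_split a b c : 0 <= b -> 0 <= c -> riesz_abs a <= b + c ->
  exists a1 a2, [/\ a = a1 + a2, riesz_abs a1 <= b & riesz_abs a2 <= c].
Proof.
move=> b0 c0 /(@riesz_abs_leP a)[abc nabc].
have [||||u [v [/andP[u0 ub] /andP[v0 vc] E1]]] := @riesz_split _ _ (b + b) (c + c) (a + (b + c)).
- exact: riesz_addr_ge0.
- exact: riesz_addr_ge0.
- by rewrite -(riesz_leD2l (- a)) addKr addr0.
- by rewrite addrACA riesz_leD2r.
exists (u - b), (v - c); split; [|exact: riesz_abs_sub_le|exact: riesz_abs_sub_le].
by rewrite addrACA -opprD -E1 addrK.
Qed.

(** Added to the meet of [x] and [y], the meet of the two remainders still lies below both vectors,
    hence below their meet. *)
Lemma riesz_meet_subl x y : riesz_meet (x - riesz_meet x y) (y - riesz_meet x y) = 0.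
Proof.
apply/le_anti; rewrite riesz_meetP !riesz_subr_ge0 riesz_meet_lel riesz_meet_ler !andbT.
set m := riesz_meet x y; set z := riesz_meet _ _.
have zx : z + m <= x by rewrite -[leRHS](subrK m) riesz_leD2r riesz_meet_lel.
have zy : z + m <= y by rewrite -[leRHS](subrK m) riesz_leD2r riesz_meet_ler.
have : z + m <= m by rewrite {2}/m riesz_meetP zx zy.
by rewrite -{2}[m]add0r riesz_leD2r.
Qed.

Lemma riesz_meet_ge0 x y : 0 <= x -> 0 <= y -> 0 <= riesz_meet x y.
Proof. by rewrite riesz_meetP => -> ->. Qed.

Lemma riesz_le_meet x y x' y' : x <= x' -> y <= y' -> riesz_meet x y <= riesz_meet x' y'.
Proof.
move=> xx yy; rewrite riesz_meetP (le_trans (riesz_meet_lel _ _) xx).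
by rewrite (le_trans (riesz_meet_ler _ _) yy).
Qed.

Lemma riesz_meetC x y : riesz_meet x y = riesz_meet y x.
Proof. by apply/le_anti; rewrite !riesz_meetP !riesz_meet_lel !riesz_meet_ler. Qed.

Lemma riesz_meetD_le x y z : 0 <= x -> 0 <= y -> 0 <= z ->
  riesz_meet (x + y) z <= riesz_meet x z + riesz_meet y z.
Proof.
move=> x0 y0 z0; set t := riesz_meet _ _.
have txy : t <= x + y by exact: riesz_meet_lel.
have tz : t <= z by exact: riesz_meet_ler.
have t0 : 0 <= t by rewrite riesz_meet_ge0 ?riesz_addr_ge0.
have [u [v [/andP[u0 ux] /andP[v0 vy] tE]]] := riesz_split x0 y0 t0 txy.
have uz : u <= z by apply: le_trans tz; rewrite tE -[leLHS]addr0 riesz_leD2l.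
have vz : v <= z by apply: le_trans tz; rewrite tE -[leLHS]add0r riesz_leD2r.
by rewrite tE riesz_leD// riesz_meetP ?ux ?vy.
Qed.

Lemma riesz_leD_meet x y z z' :
  riesz_meet x z + riesz_meet y z' <= riesz_meet (x + y) (z + z').
Proof. by rewrite riesz_meetP !riesz_leD ?riesz_meet_lel ?riesz_meet_ler. Qed.

Lemma riesz_mulrn_ge0 x n : 0 <= x -> 0 <= x *+ n.
Proof. by move=> x0; elim: n => [|n IH]; rewrite ?mulr0n// mulrSr riesz_addr_ge0. Qed.

Lemma riesz_le_mulrn x m n : 0 <= x -> (m <= n)%N -> x *+ m <= x *+ n.
Proof.
by move=> x0 mn; rewrite -riesz_subr_ge0 -mulrnBr// riesz_mulrn_ge0.
Qed.

Lemma riesz_le_mulrn2 x y n : x <= y -> x *+ n <= y *+ n.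
Proof. by move=> xy; elim: n => [|n IH]; rewrite ?mulr0n// !mulrSr riesz_leD. Qed.

Lemma riesz_meet_mulrn0 x y n : 0 <= x -> 0 <= y ->
  riesz_meet x y = 0 -> riesz_meet x (y *+ n) = 0.
Proof.
move=> x0 y0 xy; apply/le_anti; rewrite riesz_meet_ge0 ?riesz_mulrn_ge0// andbT.
elim: n => [|n IH]; first by rewrite mulr0n riesz_meet_ler.
rewrite riesz_meetC mulrSr; apply: le_trans (riesz_meetD_le _ _ _) _ => //.
  exact: riesz_mulrn_ge0.
by rewrite riesz_meetC [X in _ + X]riesz_meetC xy addr0.
Qed.

(** Subtracting the meet from the positive part leaves an upper bound of [x] and [0], so the meet
    cannot exceed [0]. *)
Lemma riesz_disjoint_pos x : riesz_meet (riesz_pos x) (riesz_pos x - x) = 0.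
Proof.
apply/le_anti; rewrite riesz_meet_ge0 ?riesz_pos_ge0 ?riesz_posBge0// andbT.
set z := riesz_meet _ _.
have : riesz_pos x <= riesz_pos x - z.
  rewrite {1}/riesz_pos riesz_joinP; apply/andP; split; last first.
    by rewrite riesz_subr_ge0 riesz_meet_lel.
  rewrite -riesz_subr_ge0 addrAC riesz_subr_ge0; exact: riesz_meet_ler.
by rewrite -riesz_subr_ge0 addrAC subrr sub0r -riesz_oppr_le0 opprK.
Qed.

End RieszFacts.

Lemma arch_le0 (R : realType) (r s : R) : (forall n : nat, r *+ n <= s) -> r <= 0.
Proof.
move=> rs; have [//|r0] := leP r 0; exfalso.
have := rs (Num.truncn (s / r)).+1; apply/negP; rewrite -ltNge -mulr_natl.
by rewrite -ltr_pdivrMr// truncnS_gt.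
Qed.

Lemma small_le0 (R : realFieldType) (r s : R) :
  (forall e, 0 < e -> r <= s + e) -> r <= s.
Proof.
move=> rs; have [//|r0] := leP r s; exfalso.
have : r <= s + (r - s) / 2 by apply: rs; lra.
by lra.
Qed.

(** * Approximate Riesz-Kantorovich formulas in the order dual *)

Section DualFacts.
Variables (R : realType) (E : rieszType R).
Implicit Types (e : R) (x y z : E) (f g h u v w : order_dual E).

Lemma order_dual0 x : (0 : order_dual E) x = 0.
Proof. by []. Qed.

Lemma dual_leD f x y : 0 <= f -> x <= y -> f x <= f y.
Proof.
move=> /order_dual_ge0P f0 xy.
by rewrite -subr_ge0 -linearB f0// riesz_subr_ge0.
Qed.

Lemma dual_ge0 f x : 0 <= f -> 0 <= x -> 0 <= f x.
Proof. by move=> /order_dual_ge0P f0 /f0. Qed.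

Lemma dual_le f g x : f <= g -> 0 <= x -> f x <= g x.
Proof. by move=> /order_dual_leP fg /fg. Qed.

Lemma dual_abs_le f g x y : riesz_abs g <= f -> riesz_abs x <= y -> `|g x| <= f y.
Proof.
move=> /riesz_abs_leP[gf gf'] /riesz_abs_leP[xy xy'].
have x1 : 0 <= y - x by rewrite riesz_subr_ge0.
have x2 : 0 <= y + x by rewrite -[x]opprK riesz_subr_ge0.
have := dual_le gf x1; have := dual_le gf' x1; have := dual_le gf x2; have := dual_le gf' x2.
by rewrite !order_dualN !linearD !linearN /= ler_norml; lra.
Qed.

Lemma dual_abs_le0 f x y : 0 <= f -> riesz_abs x <= y -> `|f x| <= f y.
Proof. by move=> f0; apply: dual_abs_le; rewrite riesz_ge0_abs. Qed.

Lemma dual_pos_abs_le g f x : 0 <= x -> riesz_abs g <= f -> `|g x| <= f x.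
Proof. by move=> x0 gf; apply: dual_abs_le => //; rewrite riesz_ge0_abs. Qed.

(* Additivity and positivity on the cone already force homogeneity. *)
Lemma cone_functional (p : E -> R) :
  (forall x y, 0 <= x -> 0 <= y -> p (x + y) = p x + p y) ->
  (forall x, 0 <= x -> 0 <= p x) ->
  exists g : order_dual E, forall x, 0 <= x -> g x = p x.
Proof.
move=> pD p0.
have p_le x y : 0 <= x -> x <= y -> p x <= p y.
  move=> x0 xy; rewrite -[y](subrK x) pD ?riesz_subr_ge0// lerDr.
  by rewrite p0// riesz_subr_ge0.
have p00 : p 0 = 0 by have := pD 0 0 (lexx _) (lexx _); rewrite addr0; lra.
have pMn x n : 0 <= x -> p (x *+ n) = p x *+ n.
  move=> x0; elim: n => [|n IH]; first by rewrite !mulr0n.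
  by rewrite !mulrSr pD ?riesz_mulrn_ge0// IH.
have pZ a x : 0 <= a -> 0 <= x -> p (a *: x) = a * p x.
  (* With [k] the integer part of [a n], monotonicity puts [n p (a x)] and [a n p x] between [k p x]
     and [(k + 1) p x]. Their gap stays below [p x] for every [n], so the Archimedean property of
     the reals closes it. *)
  move=> a0 x0; have bnd n : `|p (a *: x) - a * p x| *+ n <= p x.
    have an0 : 0 <= a * n%:R by rewrite mulr_ge0.
    set k := Num.truncn (a * n%:R).
    have /andP[ka ak] := truncn_itv an0; rewrite -/k in ka ak.
    have zE : p (a *: x) * n%:R = p ((a * n%:R) *: x).
      by rewrite mulr_natr -pMn ?riesz_scaler_ge0// -scaler_nat scalerA mulrC.
    have ub : p ((a * n%:R) *: x) <= k.+1%:R * p x.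
      rewrite mulr_natl -pMn// -scaler_nat; apply: p_le; first exact: riesz_scaler_ge0.
      by rewrite -riesz_subr_ge0 -scalerBl riesz_scaler_ge0// subr_ge0 ltW.
    have lb : k%:R * p x <= p ((a * n%:R) *: x).
      rewrite mulr_natl -pMn// -scaler_nat; apply: p_le; first exact: riesz_scaler_ge0.
      by rewrite -riesz_subr_ge0 -scalerBl riesz_scaler_ge0// subr_ge0.
    have px := p0 _ x0.
    have n0 : 0 <= n%:R :> R by [].
    rewrite -mulr_natr -(ger0_norm n0) -normrM mulrBl zE mulrAC.
    move: ub lb; rewrite -natr1 => ub lb.
    have kp : k%:R * p x <= a * n%:R * p x by rewrite ler_wpM2r.
    have kp' : a * n%:R * p x <= (k%:R + 1) * p x by rewrite ler_wpM2r// natr1 ltW.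
    by rewrite ler_norml; move: kp kp' ub lb; rewrite mulrDl mul1r; lra.
  have := arch_le0 bnd; rewrite normr_le0 subr_eq0 => /eqP; exact.
pose P x : R^o := p (riesz_pos x) - p (riesz_pos x - x).
have PE (u v : E) : 0 <= u -> 0 <= v -> P (u - v) = p u - p v.
  move=> u0 v0; set x := u - v; have [w0 z0] := (riesz_pos_ge0 x, riesz_posBge0 x).
  have : p (riesz_pos x) + p v = p u + p (riesz_pos x - x).
    rewrite -!pD//; congr p; move: (riesz_pos x) => w.
    by rewrite /x opprB [RHS]addrCA [u + _]addrC subrK.
  by rewrite /P; lra.
have lP : linear P.
  move=> a x y.
  have [xp xn] := (riesz_pos_ge0 x, riesz_posBge0 x).
  have [yp yn] := (riesz_pos_ge0 y, riesz_posBge0 y).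
  rewrite -[x](subKr (riesz_pos x)) -[y](subKr (riesz_pos y)).
  move: (riesz_pos x) (riesz_pos x - x) xp xn => u v u0 v0.
  move: (riesz_pos y) (riesz_pos y - y) yp yn => u' v' u'0 v'0.
  rewrite !PE// -[RHS]/(a * (p u - p v) + (p u' - p v')).
  have [a0|/ltW a0] := lerP 0 a.
    have -> : a *: (u - v) + (u' - v') = (a *: u + u') - (a *: v + v').
      by rewrite scalerBr opprD addrACA.
    by rewrite PE ?riesz_addr_ge0 ?riesz_scaler_ge0// !pD ?riesz_scaler_ge0// !pZ//; lra.
  have Na0 : 0 <= - a by rewrite oppr_ge0.
  have -> : a *: (u - v) + (u' - v') = (- a *: v + u') - (- a *: u + v').
    by rewrite !scaleNr opprD opprK addrACA [- _ + _]addrC -scalerBr.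
  by rewrite PE ?riesz_addr_ge0 ?riesz_scaler_ge0// !pD ?riesz_scaler_ge0// !pZ//; lra.
have Pp x : 0 <= x -> P x = p x by move=> x0; rewrite -{1}[x]subr0 PE// p00 subr0.
have P0 x : 0 <= x -> 0 <= P x by move=> x0; rewrite Pp// p0.
by exists (order_dual_of lP (positive_order_bounded lP P0)) => x /Pp.
Qed.

(** The supremum of [f] over [[0, x]] is additive in [x] by Riesz decomposition, so it extends to a
    functional above [f] and [0], hence above the positive part of [f]. A near-maximizer is the
    required [y]. *)
Lemma dual_pos_approx f x e : 0 <= x -> 0 < e ->
  exists y, [/\ 0 <= y, y <= x & riesz_pos f x <= f y + e].
Proof.
pose S x : set R := [set (f y : R) | y in [set y | 0 <= y <= x]]%classic.
have S_sup z : 0 <= z -> has_sup (S z).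
  move=> z0; split; first by exists (f 0), 0 => //=; rewrite lexx z0.
  have [c [d H]] := order_dual_bounded f 0 z.
  by exists d => _ [y /H/andP[_ yd] <-].
have ub z y : 0 <= y -> y <= z -> f y <= sup (S z).
  move=> y0 yz; apply: ub_le_sup; first by case: (S_sup _ (le_trans y0 yz)).
  by exists y => //=; rewrite y0.
have lub z M : 0 <= z -> (forall y, 0 <= y -> y <= z -> f y <= M) -> sup (S z) <= M.
  move=> z0 H; apply: ge_sup; first by case: (S_sup _ z0).
  by move=> _ [y /= /andP[y0 yz] <-]; exact: H.
have [||g gE] := @cone_functional (fun z => sup (S z)).
- move=> y z y0 z0; apply/le_anti/andP; split.
    apply: (lub) => [|t t0 tyz]; first exact: riesz_addr_ge0.
    have [a [b [/andP[a0 ay] /andP[b0 bz] ->]]] := riesz_split y0 z0 t0 tyz.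
    by rewrite linearD lerD ?ub.
  rewrite -lerBrDr; apply: (lub) => // a a0 ay.
  rewrite lerBrDr addrC -lerBrDr; apply: (lub) => // b b0 bz.
  by rewrite lerBrDr addrC -linearD ub ?riesz_addr_ge0 ?riesz_leD.
- by move=> z z0; rewrite -(linear0 f) ub.
move=> x0 e0.
have fg : riesz_pos f <= g.
  rewrite /riesz_pos riesz_joinP; apply/andP; split; apply/order_dual_leP => z z0.
    by rewrite gE// ub.
  by rewrite gE// -[leLHS]/(0 : R) -(linear0 f) ub.
have [_ [y /= /andP[y0 yx] <-] ye] := sup_adherent e0 (S_sup _ x0).
exists y; split=> //; apply: le_trans (dual_le fg x0) _.
by rewrite gE//; move: ye; lra.
Qed.

(** Since [|f| = 2 f^+ - f], a near-maximizer [y] for the positive part yields [2 y - x]. *)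
Lemma dual_abs_approx f x e : 0 <= x -> 0 < e ->
  exists y, riesz_abs y <= x /\ riesz_abs f x <= f y + e.
Proof.
move=> x0 e0; have e20 : 0 < e / 2 by lra.
have [y [y0 yx fy]] := dual_pos_approx f x0 e20.
exists (y + y - x); split.
  by apply: riesz_abs_sub_le; rewrite ?riesz_addr_ge0 ?riesz_leD.
rewrite riesz_abs_pos order_dualD order_dualB linearB linearD /=; lra.
Qed.

(** The meet dominates [u - (u - v)^+], so it is enough to let [z] be a near-maximizer of [u - v] on
    [[0, x]]. *)
Lemma dual_meet_approx u v x e : 0 <= x -> 0 < e ->
  exists y z, [/\ 0 <= y, 0 <= z, x = y + z & u y + v z <= riesz_meet u v x + e].
Proof.
move=> x0 e0; have [z [z0 zx uvz]] := dual_pos_approx (u - v) x0 e0.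
exists (x - z), z; split=> //; first by rewrite riesz_subr_ge0.
  by rewrite subrK.
have : u - riesz_pos (u - v) <= riesz_meet u v.
  rewrite riesz_meetP !riesz_leBl; apply/andP; split.
    by rewrite -[leLHS]addr0 riesz_leD2l riesz_pos_ge0.
  by rewrite addrC -riesz_leBl riesz_pos_ge.
move=> /dual_le/(_ x0); move: uvz; rewrite !order_dualB linearB; lra.
Qed.

Lemma dual_meet_le u v y z : 0 <= y -> 0 <= z ->
  riesz_meet u v (y + z) <= u y + v z.
Proof.
move=> y0 z0; rewrite linearD lerD//; apply: dual_le => //.
  exact: riesz_meet_lel.
exact: riesz_meet_ler.
Qed.

(** This turns disjointness in a dual into a splitting of arguments. It serves twice: to exploit
    disjointness in the bidual of [E i], and to prove it in the bidual of [F]. *)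
Lemma dual_disjointP u v : riesz_disjoint u v <->
  forall x e, 0 <= x -> 0 < e -> exists y z,
    [/\ 0 <= y, 0 <= z, x = y + z, riesz_abs u y <= e & riesz_abs v z <= e].
Proof.
rewrite /riesz_disjoint; split=> [uv x e x0 e0|uv].
  have [y [z [y0 z0 xE]]] := dual_meet_approx (riesz_abs u) (riesz_abs v) x0 e0.
  rewrite uv order_dual0 => le; exists y, z.
  have := dual_ge0 (riesz_abs_ge0 u) y0; have := dual_ge0 (riesz_abs_ge0 v) z0.
  by split=> //; lra.
apply: order_dual_eqP => x x0; apply/le_anti/andP; split; last first.
  by apply: dual_le => //; rewrite riesz_meet_ge0// riesz_abs_ge0.
apply: small_le0 => e e0; have e20 : 0 < e / 2 by lra.
have [y [z [y0 z0 -> uy vz]]] := uv x (e / 2) x0 e20.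
have := dual_meet_le (riesz_abs u) (riesz_abs v) y0 z0.
by rewrite order_dual0; lra.
Qed.

End DualFacts.

(** * Components of a functional on carrier bands *)

Section Components.
Variables (R : realType) (E : rieszType R).
Implicit Types (e : R) (x y z : E) (f g h w : order_dual E).

(** The pointwise supremum of the increasing sequence is additive: doubling the index in the
    superadditivity hypothesis is harmless, because the supremum absorbs it. The doubling is what
    truncations by [z *+ n] produce. *)
Lemma sup_functional (s : nat -> E -> R) f :
  (forall n x, 0 <= x -> 0 <= s n x) ->
  (forall n x, 0 <= x -> s n x <= f x) ->
  (forall m n x, (m <= n)%N -> 0 <= x -> s m x <= s n x) ->
  (forall n x y, 0 <= x -> 0 <= y -> s n (x + y) <= s n x + s n y) ->
  (forall n x y, 0 <= x -> 0 <= y -> s n x + s n y <= s (n + n)%N (x + y)) ->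
  exists h, [/\ 0 <= h, h <= f, forall n x, 0 <= x -> s n x <= h x &
    forall x e, 0 <= x -> 0 < e -> exists n, h x <= s n x + e].
Proof.
move=> s0 sf s_mono s_sub s_super; pose S x := range (s^~ x).
have S_sup x : 0 <= x -> has_sup (S x).
  by move=> x0; split; [exists (s 0 x), 0|exists (f x) => _ [n _ <-]; exact: sf].
have ub n x : 0 <= x -> s n x <= sup (S x).
  by move=> x0; apply: ub_le_sup; [case: (S_sup _ x0)|exists n].
have lub x M : 0 <= x -> (forall n, s n x <= M) -> sup (S x) <= M.
  move=> x0 H; apply: ge_sup; first by case: (S_sup _ x0).
  by move=> _ [n _ <-].
have [||h hE] := @cone_functional _ _ (fun x => sup (S x)).
- move=> x y x0 y0; apply/le_anti/andP; split.
    apply: (lub) => [|n]; first exact: riesz_addr_ge0.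
    by apply: le_trans (s_sub _ _ _ x0 y0) _; rewrite lerD ?ub.
  rewrite -lerBrDr; apply: (lub) => // m; rewrite lerBrDr addrC -lerBrDr.
  apply: (lub) => // n; rewrite lerBrDr addrC.
  apply: le_trans (ub (maxn m n + maxn m n)%N _ (riesz_addr_ge0 x0 y0)).
  apply: le_trans (s_super _ _ _ x0 y0).
  by apply: lerD; apply: s_mono; rewrite ?leq_maxl ?leq_maxr.
- by move=> x x0; apply: le_trans (ub 0%N x x0); exact: s0.
exists h; split=> [||n x x0|x e x0 e0].
- by apply/order_dual_ge0P => x x0; rewrite hE//; apply: le_trans (ub 0%N x x0); exact: s0.
- by apply/order_dual_leP => x x0; rewrite hE//; apply: lub => // n; exact: sf.
- by rewrite hE// ub.
have [_ [n _ <-] sn] := sup_adherent e0 (S_sup _ x0).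
by exists n; rewrite hE//; lra.
Qed.

(* [h] is the projection of [f] onto the carrier band of [z]. *)
Definition is_component f z h := [/\ 0 <= h, h <= f,
  forall n x, 0 <= x -> f (riesz_meet x (z *+ n)) <= h x &
  forall x e, 0 <= x -> 0 < e -> exists n, h x <= f (riesz_meet x (z *+ n)) + e].

Lemma component_exists f z : 0 <= f -> 0 <= z -> exists h, is_component f z h.
Proof.
move=> f0 z0; apply: (@sup_functional (fun n x => f (riesz_meet x (z *+ n)))).
- by move=> n x x0; rewrite dual_ge0// riesz_meet_ge0// riesz_mulrn_ge0.
- by move=> n x x0; rewrite dual_leD// riesz_meet_lel.
- by move=> m n x mn x0; rewrite dual_leD// riesz_le_meet// riesz_le_mulrn.
- by move=> n x y x0 y0; rewrite -linearD dual_leD// riesz_meetD_le// riesz_mulrn_ge0.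
- by move=> n x y x0 y0; rewrite -linearD dual_leD// mulrnDr riesz_leD_meet.
Qed.

Lemma component_self f z h : 0 <= z -> is_component f z h -> h z = f z.
Proof.
move=> z0 [_ hf fh _]; apply/le_anti; rewrite (dual_le hf)//=.
have := fh 1%N z z0; rewrite mulr1n; congr (_ <= _); congr (f _).
by apply/le_anti; rewrite riesz_meet_lel riesz_meetP lexx.
Qed.

Lemma component_disjoint f z h x : 0 <= x -> 0 <= z -> is_component f z h ->
  riesz_meet x z = 0 -> h x = 0.
Proof.
move=> x0 z0 [h0 _ _ hn] xz; apply/le_anti; rewrite (dual_ge0 h0)// andbT.
apply: small_le0 => e e0; have [n] := hn x e x0 e0.
by rewrite riesz_meet_mulrn0// linear0.
Qed.

Lemma component_le f z z' h h' : 0 <= f -> z <= z' -> is_component f z h ->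
  is_component f z' h' -> h <= h'.
Proof.
move=> f0 zz [_ _ _ hn] [_ _ h'n _]; apply/order_dual_leP => x x0.
apply: small_le0 => e e0; have [n hx] := hn x e x0 e0.
apply: le_trans hx _; rewrite lerD2r; apply: le_trans (h'n n x x0).
by rewrite dual_leD// riesz_le_meet// riesz_le_mulrn2.
Qed.

(** As [g z = 0], [g] vanishes on each truncation of [x] by a multiple of [z]; what remains of [x]
    has a small value under [h], which dominates [g]. *)
Lemma component_null f z h g : 0 <= z -> is_component f z h -> 0 <= g -> g <= h ->
  g z = 0 -> g = 0.
Proof.
move=> z0 [h0 hf fh hn] g0 gh gz; apply: order_dual_eqP => x x0.
apply/le_anti; rewrite order_dual0 (dual_ge0 g0)// andbT.
apply: small_le0 => e e0; have [n hx] := hn x e x0 e0.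
pose t := riesz_meet x (z *+ n).
have t0 : 0 <= t by rewrite riesz_meet_ge0// riesz_mulrn_ge0.
have gt : g t <= g (z *+ n) by rewrite dual_leD// riesz_meet_ler.
rewrite linearMn /= gz mul0rn in gt.
(* The truncation [t] is unchanged by truncating it again at [z *+ n]. *)
have fht : f t <= h t.
  have := fh n t t0; congr (_ <= _); congr (f _).
  by apply/le_anti; rewrite riesz_meet_lel riesz_meetP lexx riesz_meet_ler.
have xt0 : 0 <= x - t by rewrite riesz_subr_ge0 riesz_meet_lel.
have := dual_le gh xt0; rewrite !linearB /=.
by move: hx; rewrite -/t; lra.
Qed.

End Components.

(** * The modulus of an order continuous functional along decreasing nets *)

Section OrderContinuousFunctionals.
Variables (R : realType) (G : rieszType R).

Lemma real_net_decr0 (I : Type) (r : I -> I -> Prop) (z : I -> R^o) (e : R) :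
  net_decr0 r z -> 0 < e -> exists i, (z i : R) <= e.
Proof.
move=> [_ _ zinf] e0; apply: contrapT => H.
have : (e : R^o) <= 0; last by apply/negP; rewrite -ltNge.
by apply: zinf => i; rewrite leNgt; apply/negP => /ltW zi; apply: H; exists i.
Qed.

(** Choose [h] with [|h| <= y i0] and [w h] close to [|w| (y i0)]. Splitting [h] into [t i], bounded
    by [y i], and a rest bounded by [y i0 - y i] gives a net [t] converging to [0] in order. Then
    [w (t k)] is small for late [k], and the rest contributes at most [|w| (y i0) - |w| (y k)]. *)
Lemma order_continuous_abs (w : order_dual G) (I : Type) (r : I -> I -> Prop)
    (y : I -> G) (e : R) :
  order_continuous_dual w -> directed r -> net_decr0 r y -> 0 < e ->
  exists i, riesz_abs w (y i) <= e.
Proof.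
move=> wc dr y_decr e0; have [[i0] _ rtrans rub] := dr.
have [ymono y0 yinf] := y_decr.
have e20 : 0 < e / 2 by lra.
have [h [hy wh]] := dual_abs_approx w (y0 i0) e20.
have /choice[t tP] : forall i, exists t, riesz_abs t <= y i /\
    (r i0 i -> riesz_abs (h - t) <= y i0 - y i).
  move=> i; have [ri|nri] := pselect (r i0 i); last first.
    (* Indices not beyond [i0] get the default [0]; only the tail matters, but the bound by [y i]
       must hold everywhere. *)
    by exists 0; split=> //; rewrite riesz_ge0_abs.
  have [|||a [b [-> ay bz]]] := @riesz_signed_split _ _ h (y i) (y i0 - y i) => //.
  - by rewrite riesz_subr_ge0 ymono.
  - by rewrite addrC subrK.
  - by exists a; split=> // _; rewrite addrAC subrr add0r.
have tcvg : order_cvg r t 0 by exists y => // i; rewrite subr0; case: (tP i).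
have [z zdecr wz] := wc I r t dr tcvg.
have [i zi] := real_net_decr0 zdecr e20.
have [k [rik ri0k]] := rub i i0; exists k.
have [zmono _ _] := zdecr.
have wt : w (t k) <= e / 2.
  apply: le_trans (le_trans _ (wz k)) (le_trans (zmono _ _ rik) zi).
  by rewrite -{1}[w (t k)]subr0; exact: riesz_abs_ge.
have [_ /(_ ri0k) htk] := tP k.
have := @dual_abs_le _ _ (riesz_abs w) w _ _ (lexx _) htk.
rewrite ler_norml !linearB /= => /andP[]; lra.
Qed.

End OrderContinuousFunctionals.

(** * Absolute continuity with respect to evaluations *)

Section AbsoluteContinuity.
Variables (R : realType) (E : rieszType R).
Implicit Types (e : R) (x y z : E) (f g h : order_dual E) (w : order_bidual E).

(** The components of [f] at the positive parts of all vectors form an increasing net indexed by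
    [E]. They exhaust [f]: the component at [x >= 0] agrees with [f] at [x], so a lower bound of the
    remainders is at most [0] at each such [x]. *)
Lemma component_exhausts w f e : order_continuous_dual w -> 0 <= f -> 0 < e ->
  exists z h, [/\ 0 <= z, is_component f z h & riesz_abs w (f - h) <= e].
Proof.
move=> wc f0 e0.
have /choice[c cP] : forall z : E, exists h, is_component f (riesz_pos z) h.
  by move=> z; apply: component_exists => //; exact: riesz_pos_ge0.
have pos_le x y : x <= y -> riesz_pos x <= riesz_pos y.
  move=> xy; rewrite /riesz_pos riesz_joinP riesz_join_ler andbT.
  exact: le_trans xy (riesz_join_lel _ _).
pose r x y : Prop := x <= y.
have dr : directed r.
  split=> [|x|x y z|x y]; [exact: inhabits 0|exact: lexx|exact: le_trans|].
  by exists (riesz_join x y); rewrite /r riesz_join_lel riesz_join_ler.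
have decr : net_decr0 r (fun z => f - c z).
  split=> [x y xy|z|l lf].
  - by rewrite riesz_leD2l riesz_leN2; apply: component_le f0 (pos_le _ _ xy) _ _.
  - by rewrite riesz_subr_ge0; case: (cP z).
  apply/order_dual_leP => x x0; apply: le_trans (dual_le (lf x) x0) _.
  have pE : riesz_pos x = x.
    by apply/le_anti; rewrite riesz_pos_ge /riesz_pos riesz_joinP lexx x0.
  have := component_self (riesz_pos_ge0 x) (cP x); rewrite pE => cx.
  by rewrite order_dualB cx subrr.
have [z wz] := order_continuous_abs wc dr decr e0.
by exists (riesz_pos z), (c z); split=> //; exact: riesz_pos_ge0.
Qed.

(** A Borel-Cantelli argument. If it fails, there are [g k] below [h] with [g k z] at most
    [2^-(k+1)] but [|w| (g k) >= e]. The suprema [H' n] of the capped tail sums decrease to a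
    functional that vanishes at [z], hence to [0] by [component_null], whereas
    [|w| (H' n) >= |w| (g n) >= e]. *)
Lemma component_abs_continuous w f z h e : order_continuous_dual w -> 0 <= z ->
  is_component f z h -> 0 < e ->
  exists2 d : R, 0 < d & forall g, 0 <= g -> g <= h -> g z <= d -> riesz_abs w g < e.
Proof.
move=> wc z0 hc e0; apply: contrapT => H; have [h0 hf _ _] := hc.
have d_gt0 k : 0 < 2^-1 ^+ k :> R by rewrite exprn_gt0// invr_gt0.
have /choice[g gP] : forall k : nat, exists g,
    [/\ 0 <= g, g <= h, g z <= 2^-1 ^+ k.+1 & e <= riesz_abs w g].
  move=> k; apply: contrapT => Hk; apply: H; exists (2^-1 ^+ k.+1) => // g g0 gh gz.
  by rewrite ltNge; apply/negP => eg; apply: Hk; exists g.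
(* Tail sums from [n] on, padded with zeros below [n] so that one induction on [N] covers every
   [n]. *)
pose S n N : order_dual E := \sum_(0 <= k < N) (if (n <= k)%N then g k else 0).
have SS n N : S n N.+1 = S n N + (if (n <= N)%N then g N else 0) by rewrite /S big_nat_recr.
have gif n k : 0 <= (if (n <= k)%N then g k else 0) by case: ifP => // _; case: (gP k).
have S0 n N : 0 <= S n N.
  elim: N => [|N IH]; first by rewrite /S big_nil.
  by rewrite SS riesz_addr_ge0.
have S_mono n M N : (M <= N)%N -> S n M <= S n N.
  move/subnK <-; elim: (N - M)%N => [|k IH] //.
  by rewrite addSn SS; apply: le_trans IH _; rewrite -[leLHS]addr0 riesz_leD2l.
have S_anti m n N : (m <= n)%N -> S n N <= S m N.
  move=> mn; elim: N => [|N IH]; first by rewrite /S !big_nil.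
  rewrite !SS riesz_leD//; case: ifP => [nN|_]; last exact: gif.
  by rewrite (leq_trans mn nN).
have Sz n N : S n N z <= if (n <= N)%N then 2^-1 ^+ n - 2^-1 ^+ N else 0.
  elim: N => [|N IH].
    by rewrite /S big_nil order_dual0; case: ifP => //; rewrite leqn0 => /eqP ->; rewrite subrr.
  rewrite SS order_dualD; have [nN|nN|nN] := ltngtP n N.+1.
  - rewrite ltnS in nN; rewrite nN in IH *; have [_ _ gz _] := gP N.
    by move: gz IH; rewrite exprS; lra.
  - have nN' : (n <= N)%N = false by apply/negbTE; rewrite -ltnNge ltnW.
    by rewrite nN' in IH *; rewrite order_dual0 addr0.
  - by rewrite nN ltnn in IH *; rewrite order_dual0 addr0 subrr.
have Sz' n N : S n N z <= 2^-1 ^+ n.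
  apply: le_trans (Sz n N) _; case: ifP => _; last exact: ltW.
  by rewrite gerBl ltW.
(* Capping at [h] bounds the tail sums, so that their supremum over [N] exists. *)
pose T n N := riesz_meet h (S n N).
have T0 n N : 0 <= T n N by rewrite riesz_meet_ge0.
have Th n N : T n N <= h by exact: riesz_meet_lel.
have /choice[H' HP] : forall n, exists h', [/\ 0 <= h', h' <= h,
    forall N x, 0 <= x -> T n N x <= h' x &
    forall x d, 0 <= x -> 0 < d -> exists N, h' x <= T n N x + d].
  move=> n; apply: (sup_functional (s := fun N x => T n N x)).
  - by move=> N x; exact: dual_ge0.
  - by move=> N x; exact: dual_le.
  - by move=> M N x MN x0; rewrite dual_le// riesz_le_meet// S_mono.
  - by move=> N x y _ _; rewrite linearD.
  - by move=> N x y x0 y0; rewrite linearD lerD// dual_le// riesz_le_meet// S_mono// leq_addr.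
pose r (m n : nat) : Prop := (m <= n)%N.
have dr : directed r.
  split=> [|m|m n k|m n]; [exact: inhabits 0%N|exact: leqnn|exact: leq_trans|].
  by exists (maxn m n); rewrite /r leq_maxl leq_maxr.
have decr : net_decr0 r H'.
  split=> [m n mn|n|l lH].
  - apply/order_dual_leP => x x0; apply: small_le0 => d d0.
    have [_ _ _ /(_ x d x0 d0)[N HN]] := HP n.
    have [_ _ /(_ N x x0) TN _] := HP m.
    apply: le_trans HN _; rewrite lerD2r; apply: le_trans TN.
    by rewrite dual_le// riesz_le_meet// S_anti.
  - by case: (HP n).
  (* Each [H' n] is positive, so the positive part of [l] is again a lower bound, and
     [component_null] applies to it. *)
  apply: le_trans (riesz_pos_ge l) _.
  have lH' n : riesz_pos l <= H' n.
    by rewrite /riesz_pos riesz_joinP lH; case: (HP n).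
  suff -> : riesz_pos l = 0 by [].
  apply: (component_null z0 hc); first exact: riesz_pos_ge0.
    by apply: le_trans (lH' 0%N) _; case: (HP 0%N).
  apply/le_anti; rewrite (dual_ge0 (riesz_pos_ge0 l))// andbT.
  apply: small_le0 => d d0; rewrite add0r.
  have [k kd] : exists k : nat, 2^-1 ^+ k <= d / 2.
    exists (Num.truncn (d / 2)^-1).+1; rewrite exprVn.
    rewrite -[leRHS]invrK lef_pV2 ?posrE ?exprn_gt0 ?invr_gt0//; last by lra.
    rewrite -natrX; apply: ltW; apply: lt_trans (truncnS_gt _) _.
    by rewrite ltr_nat ltn_expl.
  have d20 : 0 < d / 2 by lra.
  have [_ _ _ /(_ z (d / 2) z0 d20)[N HN]] := HP k.
  have := dual_le (lH' k) z0.
  have : T k N z <= S k N z by rewrite dual_le// riesz_meet_ler.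
  by move: HN (Sz' k N) kd; lra.
have e20 : 0 < e / 2 by lra.
have [i wi] := order_continuous_abs wc dr decr e20.
have [gi0 gih _ egi] := gP i.
have : g i <= H' i.
  apply/order_dual_leP => x x0; have [_ _ /(_ i.+1 x x0) TH _] := HP i.
  apply: le_trans TH; rewrite dual_le// /T riesz_meetP gih SS leqnn.
  by rewrite -[X in X <= _]add0r riesz_leD2r S0.
move=> /(dual_leD (riesz_abs_ge0 w)); move: egi wi; lra.
Qed.

(** Outside a component [h] of [f] the modulus of [w] is small. Inside, either [g1 z] is at most [d]
    and [|w| g1] is small, or [g1 z] exceeds [d] and the multiple [n] with [n d >= |w| h] makes
    [g1 (z *+ n)] dominate. *)
Lemma bidual_abs_continuous w f e : order_continuous_dual w -> 0 <= f -> 0 < e ->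
  exists2 a, 0 <= a & forall g, 0 <= g -> g <= f -> riesz_abs w g <= g a + e.
Proof.
move=> wc f0 e0; have e20 : 0 < e / 2 by lra.
have [z [h [z0 hc wfh]]] := component_exhausts wc f0 e20.
have [d d0 dP] := component_abs_continuous wc z0 hc e20.
have [h0 hf _ _] := hc; have w0 := riesz_abs_ge0 w.
pose n := (Num.truncn (riesz_abs w h / d)).+1.
have wn : riesz_abs w h <= n%:R * d by rewrite -ler_pdivrMr// ltW// truncnS_gt.
exists (z *+ n) => [|g g0 gf]; first exact: riesz_mulrn_ge0.
have [||||g1 [g2 [/andP[g10 g1h] /andP[g20 g2h] ->]]] := @riesz_split _ _ h (f - h) g => //.
- by rewrite riesz_subr_ge0.
- by rewrite addrC subrK.
have g2w : riesz_abs w g2 <= e / 2 by apply: le_trans wfh; exact: dual_leD.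
have g2a : 0 <= g2 (z *+ n) by rewrite dual_ge0// riesz_mulrn_ge0.
have g1a : 0 <= g1 (z *+ n) by rewrite dual_ge0// riesz_mulrn_ge0.
rewrite linearD order_dualD /=.
have [g1z|g1z] := leP (g1 z) d.
  by have := dP g1 g10 g1h g1z; lra.
have g1w : riesz_abs w g1 <= riesz_abs w h by exact: dual_leD.
have g1n : n%:R * d <= g1 (z *+ n).
  by rewrite linearMn /= -[leRHS]mulr_natl ler_wpM2l// ltW.
by lra.
Qed.

End AbsoluteContinuity.

(** * Density of evaluations among order continuous functionals *)

Section Density.
Variables (R : realType) (E : rieszType R).
Implicit Types (e : R) (x y z a b : E) (f g h : order_dual E) (u v w : order_bidual E).

Lemma bidual_eval_linear x : linear (fun g : order_dual E => g x : R^o).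
Proof. by []. Qed.

Lemma bidual_eval_bounded x : order_bounded (fun g : order_dual E => g x : R^o).
Proof.
move=> g h; have [p0 q0] := (riesz_pos_ge0 x, riesz_posBge0 x).
rewrite -[x](subKr (riesz_pos x)); move: (riesz_pos x) (riesz_pos x - x) p0 q0 => p q p0 q0.
exists (g p - h q), (h p - g q) => k /andP[gk kh].
have := dual_le gk p0; have := dual_le gk q0; have := dual_le kh p0; have := dual_le kh q0.
by move=> *; rewrite linearB /=; apply/andP; split; lra.
Qed.

Definition bidual_eval x : order_bidual E :=
  order_dual_of (bidual_eval_linear x) (@bidual_eval_bounded x).

Lemma bidual_evalE x g : bidual_eval x g = g x.
Proof. by []. Qed.

Lemma bidual_evalD x y : bidual_eval (x + y) = bidual_eval x + bidual_eval y.
Proof. by apply: order_dual_ext => g; rewrite order_dualD !bidual_evalE linearD. Qed.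

Lemma bidual_eval_ge0 x : 0 <= x -> 0 <= bidual_eval x.
Proof. by move=> x0; apply/order_dual_ge0P => g /dual_ge0; apply. Qed.

(* [e] bounds the value at [f] of the modulus of [w - bidual_eval y]. *)
Definition approx f w y e := forall g, riesz_abs g <= f -> `|w g - g y| <= e.

Lemma approxD f w w' y y' e e' :
  approx f w y e -> approx f w' y' e' -> approx f (w + w') (y + y') (e + e').
Proof.
move=> wy wy' g gf; rewrite order_dualD linearD /= opprD addrACA.
by apply: le_trans (ler_normD _ _) _; rewrite lerD ?wy ?wy'.
Qed.

Lemma approxW f w y e e' : e <= e' -> approx f w y e -> approx f w y e'.
Proof. by move=> ee wy g gf; apply: le_trans ee; exact: wy. Qed.

(* If [w /\ (a - w)] vanished at [f], then [f] would split into two parts, on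
   which [w] is [a] and [0] respectively, and which are carried by disjoint
   parts of [a]. *)
Lemma approx_component a w f e : 0 <= a -> 0 <= f -> 0 <= w -> w <= bidual_eval a ->
  0 < e -> exists y, approx f w y (3 * riesz_meet w (bidual_eval a - w) f + e).
Proof.
move=> a0 f0 w0 wa e0; set w' := bidual_eval a - w.
have w'0 : 0 <= w' by rewrite riesz_subr_ge0.
have e50 : 0 < e / 5 by lra.
have [f2 [f1 [f20 f10 fE fw]]] := dual_meet_approx w w' f0 e50.
have [y2 [y1 [y20 y10 aE fy]]] := dual_meet_approx f2 f1 a0 e50.
(* Here [w] is small on [f2] and [w'] on [f1]. As [w + w'] is evaluation at [a], [f2] and [f1]
   overlap at [a] no more than [w] and [w'] do at [f]. *)
pose k := riesz_meet f2 f1.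
have ka : k a <= w f2 + w' f1.
  have -> : k a = w k + w' k by rewrite -bidual_evalE -order_dualD addrC subrK.
  by apply: lerD; apply: dual_leD => //; [exact: riesz_meet_lel|exact: riesz_meet_ler].
(* On functionals bounded by [f2], both [w] and evaluation at [y2] are small; on those bounded by
   [f1], [w] is close to evaluation at [a], and [y1] contributes little. *)
exists y2.
have fy' : f2 y2 + f1 y1 <= riesz_meet w w' f + e / 5 + e / 5.
  by move: fy; rewrite -/k; lra.
move=> g; rewrite {1}fE => /(riesz_signed_split f20 f10)[g2 [g1 [-> gf2 gf1]]].
have h1 := dual_abs_le0 w0 gf2; have h2 := dual_abs_le0 w'0 gf1.
have h3 := dual_pos_abs_le y20 gf2; have h4 := dual_pos_abs_le y10 gf1.
have w'E : w' g1 = g1 y2 + g1 y1 - w g1 by rewrite order_dualB bidual_evalE aE linearD.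
rewrite linearD order_dualD /= -/w'.
move: h1 h2 h3 h4 fw fy'; rewrite w'E.
by rewrite !ler_norml => /andP[? ?] /andP[? ?] /andP[? ?] /andP[? ?]; lra.
Qed.

(* Halving the range of [w] halves the total overlap [o], since the overlaps of
   the two halves [(w - a/2)^+] and [w /\ a/2] are disjoint. *)
Lemma approx_halving n a w f : 0 <= a -> 0 <= f -> 0 <= w -> w <= bidual_eval a ->
  exists o, [/\ 0 <= o, o <= w, o <= bidual_eval a - w,
    o <= bidual_eval (2^-1 ^+ n *: a) &
    forall e, 0 < e -> exists y, approx f w y (3 * o f + e)].
Proof.
move=> + f0; elim: n a w => [|n IH] a w a0 w0 wa.
  have wa0 : 0 <= bidual_eval a - w by rewrite riesz_subr_ge0.
  exists (riesz_meet w (bidual_eval a - w)); split.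
  - exact: riesz_meet_ge0.
  - exact: riesz_meet_lel.
  - exact: riesz_meet_ler.
  - by rewrite expr0 scale1r; apply: le_trans (riesz_meet_lel _ _) wa.
  - by move=> e e0; exact: approx_component.
pose b := 2^-1 *: a.
have b0 : 0 <= b by rewrite riesz_scaler_ge0// invr_ge0.
have aE : a = b + b by rewrite -mulr2n -scaler_nat scalerA mulfV ?pnatr_eq0// scale1r.
rewrite aE bidual_evalD in wa *; rewrite exprSr -scalerA -aE -/b.
set B := bidual_eval b in wa *; have B0 : 0 <= B by exact: bidual_eval_ge0.
pose w1 := riesz_pos (w - B); pose w2 := w - w1.
have w1B : w1 <= B by rewrite /w1 /riesz_pos riesz_joinP B0 riesz_leBl wa.
have w1w : w1 <= w.
  by rewrite /w1 /riesz_pos riesz_joinP w0 riesz_leBl andbT -[leLHS]addr0 riesz_leD2l.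
have w20 : 0 <= w2 by rewrite riesz_subr_ge0.
have w2B : w2 <= B by rewrite riesz_leBl addrC -riesz_leBl riesz_pos_ge.
have [o1 [o10 o1w o1B o1b o1P]] := IH b w1 b0 (riesz_pos_ge0 _) w1B.
have [o2 [o20 o2w o2B o2b o2P]] := IH b w2 b0 w20 w2B.
exists (o1 + o2); split.
- exact: riesz_addr_ge0.
- by rewrite -[leRHS](subrK w1) addrC riesz_leD.
- by rewrite -[X in _ - X](subrK w1) opprD [- _ - _]addrC addrACA riesz_leD.
- set c := bidual_eval _ in o1b o2b *.
  (* Each overlap is at most [c], so the excess [o1 + o2 - c] lies below both. But [o1 <= (w - B)^+]
     and [o2 <= B - w2 = (w - B)^-], and these are disjoint, so the excess is at most [0]. *)
  have d1 : o1 + o2 - c <= o1 by rewrite riesz_leBl riesz_leD2l.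
  have d2 : o1 + o2 - c <= o2 by rewrite riesz_leBl addrC riesz_leD2l.
  rewrite -riesz_subr_ge0 -riesz_oppr_le0 opprB -(riesz_disjoint_pos (w - B)).
  rewrite riesz_meetP (le_trans d1 o1w) (le_trans d2)//.
  by apply: le_trans o2B _; rewrite /w2 !opprB addrCA.
- move=> e e0; have e20 : 0 < e / 2 by lra.
  have [y1 Y1] := o1P _ e20; have [y2 Y2] := o2P _ e20; exists (y1 + y2).
  have := approxD Y1 Y2; rewrite [w1 + _]addrC subrK; apply: approxW.
  by rewrite order_dualD; lra.
Qed.

(** Adding the evaluation at [a] moves [w] between [0] and the evaluation at [a + a]. Since
    [n < 2^n], the chosen [n] brings the overlap at [f] down to [e / 6]. *)
Lemma approx_dominated a w f e : 0 <= f -> riesz_abs w <= bidual_eval a -> 0 <= a ->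
  0 < e -> exists y, approx f w y e.
Proof.
move=> f0 /riesz_abs_leP[wa wa'] a0 e0.
have w0 : 0 <= w + bidual_eval a by rewrite addrC -[w]opprK riesz_subr_ge0.
have wa2 : w + bidual_eval a <= bidual_eval (a + a) by rewrite bidual_evalD riesz_leD2r.
have fa : 0 <= f (a + a) by rewrite dual_ge0// riesz_addr_ge0.
pose n := (Num.truncn (6 * f (a + a) / e)).+1.
have [o [_ _ _ oa /(_ (e / 2))]] := approx_halving n (riesz_addr_ge0 a0 a0) f0 w0 wa2.
have e20 : 0 < e / 2 by lra.
move=> /(_ e20)[y ya]; exists (y - a) => g gf.
have := ya g gf; rewrite order_dualD linearB /=.
rewrite opprB addrA addrAC => /le_trans; apply.
have := dual_le oa f0; rewrite bidual_evalE linearZ /=.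
suff : 2^-1 ^+ n * f (a + a) <= e / 6 by rewrite -[_ *: _]/(2^-1 ^+ n * f (a + a)); lra.
rewrite exprVn ler_pdivrMl ?exprn_gt0//.
have : 6 * f (a + a) / e <= 2 ^+ n.
  rewrite -natrX; apply: ltW; apply: lt_trans (truncnS_gt _) _.
  by rewrite ltr_nat ltn_expl.
by rewrite ler_pdivrMr//; lra.
Qed.

(** Truncating [w] at the evaluation at [a] leaves a dominated part and an error of modulus at most
    [|w| - m]. Near-optimal splitting of [f] for the meet [m] and absolute continuity on [f2] bound
    that error at [f] by [2 e / 3]. *)
Lemma bidual_density w f e : order_continuous_dual w -> 0 <= f -> 0 < e ->
  exists y, approx f w y e.
Proof.
move=> wc f0 e0; have e30 : 0 < e / 3 by lra.
have [a a0 wa] := bidual_abs_continuous wc f0 e30.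
pose m := riesz_meet (riesz_abs w) (bidual_eval a).
have m0 : 0 <= m by rewrite riesz_meet_ge0 ?riesz_abs_ge0 ?bidual_eval_ge0.
have wm : 0 <= riesz_abs w - m by rewrite riesz_subr_ge0 riesz_meet_lel.
have [|w1 [w2 [wE w1m w2m]]] := riesz_signed_split m0 wm (a := w).
  by rewrite addrC subrK.
have [y yP] := approx_dominated f0 (le_trans w1m (riesz_meet_ler _ _)) a0 e30.
exists y => g gf; rewrite wE order_dualD addrAC.
have := yP g gf; have := dual_abs_le w2m gf.
suff : (riesz_abs w - m) f <= e / 3 + e / 3.
  by rewrite !ler_norml => ? /andP[? ?] /andP[? ?]; lra.
have [f1 [f2 [f10 f20 fE]]] := dual_meet_approx (riesz_abs w) (bidual_eval a) f0 e30.
have f2f : f2 <= f by rewrite fE -[leLHS]add0r riesz_leD2r.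
have := wa f2 f20 f2f.
by rewrite order_dualB bidual_evalE -/m fE linearD /=; lra.
Qed.

(** If [h] is the component of [f] at the positive part of [a], then [2 h - f] acts as [f] on the
    positive part and as [- f] on the negative part. *)
Lemma dual_sign_approx a f : 0 <= f ->
  exists2 g, riesz_abs g <= f & g a = f (riesz_abs a).
Proof.
move=> f0; have [p0 q0] := (riesz_pos_ge0 a, riesz_posBge0 a).
have [h hc] := component_exists f0 p0; have [h0 hf _ _] := hc.
have hp := component_self p0 hc.
have hq : h (riesz_pos a - a) = 0.
  by apply: component_disjoint hc _ => //; rewrite riesz_meetC riesz_disjoint_pos.
exists (h + h - f); first by apply: riesz_abs_sub_le; rewrite ?riesz_addr_ge0 ?riesz_leD.
rewrite riesz_abs_pos order_dualB order_dualD.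
by move: hq hp; rewrite !linearD !linearN /=; lra.
Qed.

(** Split [f] into a part where [|u|] is small and one where [|v|] is small: on the first [|a|] is
    small, on the second [|b|]. Hence [f] is small at the overlap [c] of [|a|] and [|b|], and [c]
    can be cut off both approximants. *)
Lemma bidual_density_disjoint u v f e :
  order_continuous_dual u -> order_continuous_dual v -> riesz_disjoint u v ->
  0 <= f -> 0 < e ->
  exists a b, [/\ riesz_disjoint a b, approx f u a e & approx f v b e].
Proof.
move=> uc vc uv f0 e0; have e50 : 0 < e / 5 by lra.
have [a ua] := bidual_density uc f0 e50; have [b vb] := bidual_density vc f0 e50.
pose c := riesz_meet (riesz_abs a) (riesz_abs b).
have c0 : 0 <= c by rewrite riesz_meet_ge0// riesz_abs_ge0.
have fc : f c <= 4 * (e / 5).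
  have /dual_disjointP/(_ f (e / 5) f0 e50)[g1 [g2 [g10 g20 fE ug vg]]] := uv.
  have part w y g : riesz_abs w g <= e / 5 -> 0 <= g -> g <= f ->
      approx f w y (e / 5) -> g (riesz_abs y) <= 2 * (e / 5).
    move=> wg g0 gf wy; have [h hg <-] := dual_sign_approx y g0.
    have := wy h (le_trans hg gf); have := dual_abs_le (lexx (riesz_abs w)) hg.
    by rewrite !ler_norml => /andP[? ?] /andP[? ?]; lra.
  have g1f : g1 <= f by rewrite fE -[leLHS]addr0 riesz_leD2l.
  have g2f : g2 <= f by rewrite fE -[leLHS]add0r riesz_leD2r.
  have := part u a g1 ug g10 g1f ua; have := part v b g2 vg g20 g2f vb.
  have : g1 c <= g1 (riesz_abs a) by rewrite dual_leD// riesz_meet_lel.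
  have : g2 c <= g2 (riesz_abs b) by rewrite dual_leD// riesz_meet_ler.
  by rewrite fE order_dualD; lra.
have trim w y : approx f w y (e / 5) -> c <= riesz_abs y ->
    exists2 y', riesz_abs y' <= riesz_abs y - c & approx f w y' e.
  move=> wy cy; have [|||y1 [y2 [yE y1c y2c]]] := @riesz_signed_split _ _ y (riesz_abs y - c) c.
  - by rewrite riesz_subr_ge0.
  - exact: c0.
  - by rewrite subrK.
  exists y1 => // g gf; have := wy g gf; have := dual_abs_le gf y2c.
  by rewrite {1}yE linearD /= !ler_norml => /andP[? ?] /andP[? ?]; apply/andP; split; lra.
have [a' a'c ua'] := trim u a ua (riesz_meet_lel _ _).
have [b' b'c vb'] := trim v b vb (riesz_meet_ler _ _).
exists a', b'; split=> //; apply/le_anti; rewrite riesz_meet_ge0 ?riesz_abs_ge0// andbT.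
by apply: le_trans (riesz_le_meet a'c b'c) _; rewrite riesz_meet_subl.
Qed.

End Density.

(** * Domination of multilinear operators on signed arguments *)

Section Domination.
Variables (R : realType) (m : nat) (E : 'I_m -> rieszType R) (F : rieszType R).

(** A signed [x] enters through the positive vectors [y + x] and [y - x]: the values of [M] add up
    to [2 M y], those of [L] differ by [2 L x]. *)
Lemma linear_abs_le (G : rieszType R) (L M : G -> F) (x y : G) : linear L -> linear M ->
  (forall s, 0 <= s -> riesz_abs (L s) <= M s) -> riesz_abs x <= y ->
  riesz_abs (L x) <= M y.
Proof.
move=> lL lM LM /riesz_abs_leP[xy xy'].
have LD s t : L (s + t) = L s + L t by have := lL 1 s t; rewrite !scale1r.
have MD s t : M (s + t) = M s + M t by have := lM 1 s t; rewrite !scale1r.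
have LB s t : L (s - t) = L s - L t.
  by rewrite [s - t]addrC -scaleN1r lL scaleN1r addrC.
have MB s t : M (s - t) = M s - M t.
  by rewrite [s - t]addrC -scaleN1r lM scaleN1r addrC.
have /LM/riesz_abs_leP[s1 s2] : 0 <= y - x by rewrite riesz_subr_ge0.
have /LM/riesz_abs_leP[t1 t2] : 0 <= y + x by rewrite -[x]opprK riesz_subr_ge0.
have ME : M (y + x) + M (y - x) = M y + M y by rewrite MD MB addrACA subrr addr0.
have LE : L (y + x) - L (y - x) = L x + L x.
  by rewrite LD LB opprB [L y + L x]addrC addrACA subrr addr0.
apply/riesz_abs_leP; split; apply: riesz_le_double; rewrite -ME.
  by rewrite -LE riesz_leD.
by rewrite -opprD -LE opprB addrC riesz_leD.
Qed.

Lemma positive_operator_abs_le (P : (forall i, E i) -> F) (x y : forall i, E i) :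
  multilinear P -> positive_operator P -> (forall i, riesz_abs (x i) <= y i) ->
  riesz_abs (P x) <= P y.
Proof.
(* Only the first [k] coordinates may differ; the induction frees one more coordinate at a time by
   [linear_abs_le]. *)
move=> mP pP; suff H k (s t : forall i, E i) : (forall i, riesz_abs (s i) <= t i) ->
    (forall i : 'I_m, (k <= i)%N -> s i = t i) -> riesz_abs (P s) <= P t.
  by move=> xy; apply: (H m) => // i; rewrite leqNgt ltn_ord.
elim: k s t => [|k IH] s t st kst.
  have -> : s = t by apply: functional_extensionality_dep => i; exact: kst.
  by rewrite riesz_ge0_abs//; apply: pP => i; exact: riesz_abs_dom_ge0 (st i).
have [km|mk] := ltnP k m; last first.
  by apply: IH => // i ki; have := leq_trans mk ki; rewrite leqNgt ltn_ord.
pose o := Ordinal km.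
have dfE (z : forall i, E i) : dfwith z (z o) = z.
  apply: functional_extensionality_dep => i.
  by case: (eqVneq o i) => [<-|oi]; rewrite ?dfwith_in// dfwith_out.
rewrite -(dfE s) -(dfE t).
apply: (linear_abs_le (L := fun r : E o => P (dfwith s r)) (M := fun r => P (dfwith t r))) => //.
move=> r r0; apply: IH => i.
  case: (eqVneq o i) => [<-|oi]; last by rewrite !dfwith_out.
  by rewrite !dfwith_in riesz_ge0_abs.
case: (eqVneq o i) => [<-|oi] ki; first by rewrite !dfwith_in.
rewrite !dfwith_out//; apply: kst; rewrite ltn_neqAle ki andbT.
by apply: contra oi => /eqP e; apply/eqP/val_inj.
Qed.

End Domination.

(** * Uniform approximation of iterated Arens values *)

Section FormApproximation.
Variable R : realType.

(** Stands for [|C| <= B], stated on signed tuples so that it passes directly through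
    [bidual_bar]. *)
Definition form_dom m (E : 'I_m -> rieszType R) (C B : regular_form E) : Prop :=
  forall x y : forall i, E i, (forall i, riesz_abs (x i) <= y i) -> `|C x| <= B y :> R.

Section Curry.
Variables (n : nat) (E : 'I_n.+1 -> rieszType R) (B C : regular_form E).
Hypothesis CB : form_dom C B.

Lemma form_curry_dom (y z : forall i, E (lift ord0 i)) :
  (forall i, riesz_abs (y i) <= z i) -> riesz_abs (form_curry C y) <= form_curry B z.
Proof.
move=> yz; have dom (t : E ord0) : 0 <= t -> `|C (tcons t y)| <= B (tcons t z) :> R.
  move=> t0; apply: CB => i; case: (unliftP ord0 i) => [j|] ->.
    by rewrite !tconsS.
  by rewrite !tcons0 riesz_ge0_abs.
by apply/riesz_abs_leP; split; apply/order_dual_leP => t t0;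
  rewrite ?order_dualN !form_curryE; have := dom t t0; rewrite ler_norml => /andP[]; lra.
Qed.

Lemma bidual_bar_dom (x w : order_bidual (E ord0)) : riesz_abs x <= w ->
  form_dom (bidual_bar x C) (bidual_bar w B).
Proof. by move=> xw y z yz; apply: dual_abs_le xw (form_curry_dom yz). Qed.

End Curry.

(* The approximants must be chosen from the last variable of the Arens extension
   to the first: once the later variables are fixed in the spaces [E i], the
   dependence on [x i] is through a functional in the order dual of [E i]. *)
Lemma bidual_bars_approx n (E : 'I_n -> rieszType R) (B : regular_form E) (d : pred 'I_n)
    (x x' : forall i, order_bidual (E i)) (e : R) :
  positive_operator B ->
  (forall i, order_continuous_dual (x i)) -> (forall i, order_continuous_dual (x' i)) ->
  (forall i, if d i then riesz_disjoint (x i) (x' i) else x i = x' i) -> 0 < e ->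
  exists c c' : forall i, E i,
    (forall i, if d i then riesz_disjoint (c i) (c' i) else c i = c' i) /\
    forall C : regular_form E, form_dom C B ->
      `|bidual_bars x C - C c| <= e /\ `|bidual_bars x' C - C c'| <= e.
Proof.
elim: n => [|n IH] in E B d x x' e *; move=> pB xc xc' xx' e0.
  exists (fun i : 'I_0 => False_rect _ (notF (ltn_ord i))).
  exists (fun i : 'I_0 => False_rect _ (notF (ltn_ord i))).
  by split=> [[]//|C _]; rewrite /= subrr normr0; split; exact: ltW.
have e20 : 0 < e / 2 by lra.
(* One bound for both first arguments, so that a single form dominates both curried ones in the
   induction. *)
pose w := riesz_abs (x ord0) + riesz_abs (x' ord0).
have w0 : 0 <= w by rewrite riesz_addr_ge0 ?riesz_abs_ge0.
have xw : riesz_abs (x ord0) <= w by rewrite -[leLHS]addr0 riesz_leD2l riesz_abs_ge0.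
have xw' : riesz_abs (x' ord0) <= w by rewrite -[leLHS]add0r riesz_leD2r riesz_abs_ge0.
have [c [c' [cc' cP]]] := IH (fun i => E (lift ord0 i)) (bidual_bar w B)
  (fun i => d (lift ord0 i)) (fun i => x (lift ord0 i)) (fun i => x' (lift ord0 i)) (e / 2)
  (form_curry_positive w0 pB) (fun i => xc _) (fun i => xc' _) (fun i => xx' _) e20.
(* The curried [C] at [c] and at [c'] is then dominated by [form_curry B z], which does not depend
   on [C]; the first approximants are chosen for this functional. *)
pose z i := riesz_abs (c i) + riesz_abs (c' i).
have cz i : riesz_abs (c i) <= z i by rewrite -[leLHS]addr0 riesz_leD2l riesz_abs_ge0.
have cz' i : riesz_abs (c' i) <= z i by rewrite -[leLHS]add0r riesz_leD2r riesz_abs_ge0.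
have f0 : 0 <= form_curry B z.
  apply/order_dual_ge0P => t t0; apply: pB; apply: tcons_ge0 => // i.
  exact: riesz_abs_dom_ge0 (cz i).
have [a [a' [aa' ax ax']]] : exists a a', [/\
    if d ord0 then riesz_disjoint a a' else a = a',
    approx (form_curry B z) (x ord0) a (e / 2) &
    approx (form_curry B z) (x' ord0) a' (e / 2)].
  have := xx' ord0; case: (d ord0) => [x0x'|<-].
    exact: bidual_density_disjoint.
  by have [a aP] := bidual_density (xc ord0) f0 e20; exists a, a.
exists (tcons a c), (tcons a' c'); split=> [i|C CB].
  case: (unliftP ord0 i) => [k|] ->; first by rewrite !tconsS; exact: cc'.
  by rewrite !tcons0.
(* Half of the error comes from the later arguments of the form [bidual_bar (y ord0) C], half from
   replacing [y ord0] by [b] at the functional [form_curry C s]. *)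
have step (y : forall i, order_bidual (E i)) b s : riesz_abs (y ord0) <= w ->
    (forall i, riesz_abs (s i) <= z i) -> approx (form_curry B z) (y ord0) b (e / 2) ->
    `|bidual_bars (fun i => y (lift ord0 i)) (bidual_bar (y ord0) C) -
      bidual_bar (y ord0) C s| <= e / 2 ->
    `|bidual_bars y C - C (tcons b s)| <= e.
  move=> yw sz yb ys; have := yb _ (form_curry_dom CB sz); move: ys.
  rewrite /= !ler_norml => /andP[? ?] /andP[? ?].
  by apply/andP; split; lra.
split; apply: step => //.
  by case: (cP _ (bidual_bar_dom CB xw)).
by case: (cP _ (bidual_bar_dom CB xw')).
Qed.

Lemma perm_form_dom m (E : 'I_m -> rieszType R) (rho : 'S_m) (C B : regular_form E) :
  form_dom C B -> form_dom (perm_form rho C) (perm_form rho B).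
Proof.
move=> CB x y xy; apply: CB => i.
by rewrite -[i](permKV rho) !perm_familyE.
Qed.

(** If [A = P - Q] with [P] and [Q] positive, the composition of [f] with [P + Q] dominates all [g]
    composed with [A] at once. *)
Lemma comp_form_dominated m (E : 'I_m -> rieszType R) (F : rieszType R)
    (A : regular_op E F) (f : order_dual F) : 0 <= f ->
  exists B : regular_form E, positive_operator B /\
    forall g, riesz_abs g <= f -> form_dom (comp_form g A) B.
Proof.
move=> f0; have [P [Q [pP pQ AE]]] := regular_op_decomp A.
have mP := regular_multilinear (regular_opP P).
have mQ := regular_multilinear (regular_opP Q).
pose S x := P x + Q x.
have mS : multilinear S by exact: multilinearD.
have pS : positive_operator S by move=> x x0; rewrite riesz_addr_ge0 ?pP ?pQ.
exists (comp_form f (RegularOp (positive_regular mS pS))); split.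
  exact: comp_form_positive.
move=> g gf x y xy; apply: dual_abs_le gf _; rewrite AE /= /S.
by apply: riesz_absD_le; rewrite ?riesz_absN; apply: positive_operator_abs_le.
Qed.

End FormApproximation.

(** * Splitting a functional along disjoint values of [A] *)

Theorem theorem5p1 (R : realType) (m : nat) (m_gt0 : (0 < m)%N)
    (E : 'I_m -> rieszType R) (F : rieszType R)
    (archE : forall i, archimedean_riesz (E i)) (archF : archimedean_riesz F)
    (A : regular_op E F) :
  disjointness_preserving A ->
  forall rho : 'S_m,
    disjointness_preserving_on
      (fun i => order_continuous_dual (G := order_dual (E i)))
      (arens_extension rho A).
Proof.
move=> dA rho j x xc u v uc vc uv.
have [k jE] : exists k, j = rho k by exists ((rho^-1)%g j); rewrite permKV.
subst j; apply/dual_disjointP => f e f0 e0; have e20 : 0 < e / 2 by lra.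
have [B [pB Bdom]] := comp_form_dominated A f0.
have oc (t : order_bidual (E (rho k))) : order_continuous_dual t ->
    forall i, order_continuous_dual (dfwith x t (rho i)).
  move=> tc i; case: (eqVneq k i) => [<-|ki]; first by rewrite dfwith_in.
  have rki : rho k != rho i by rewrite (inj_eq perm_inj).
  by rewrite dfwith_out//; apply: xc; rewrite eq_sym.
have [|||||c [c' [cc' cP]]] := @bidual_bars_approx R m (fun i => E (rho i)) (perm_form rho B)
  (pred1 k) (fun i => dfwith x u (rho i)) (fun i => dfwith x v (rho i)) (e / 2) => //.
- by move=> y y0; apply: pB; exact: perm_family_ge0.
- exact: oc.
- exact: oc.
- move=> i /=; rewrite eq_sym; case: (eqVneq k i) => [<-|ki]; first by rewrite !dfwith_in.
  by rewrite !dfwith_out// (inj_eq perm_inj).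
pose p := A (perm_family c); pose q := A (perm_family c').
(* The two approximating tuples agree outside slot [k] and are disjoint there, so the hypothesis on
   [A] applies. *)
have pq : riesz_disjoint p q.
  have dE (b : forall i, E (rho i)) : (forall i, i != k -> c i = b i) ->
      perm_family b = dfwith (perm_family c) (b k).
    move=> cb; apply: functional_extensionality_dep => i.
    rewrite -[i](permKV rho); move: ((rho^-1)%g i) => l; rewrite perm_familyE.
    case: (eqVneq k l) => [<-|kl]; first by rewrite dfwith_in.
    by rewrite dfwith_out ?(inj_eq perm_inj)// perm_familyE cb// eq_sym.
  have := cc' k; rewrite /= eqxx => ckk.
  rewrite /p /q (dE c)// (dE c'); last by move=> i ik; have := cc' i; rewrite /= (negbTE ik).
  by apply: dA.
(* The component of [f] at [|p|] gives the required splitting: [f - h] vanishes at [|p|], and [h]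
   vanishes at [|q|] because [q] is disjoint from [p]. *)
have [h hc] := component_exists f0 (riesz_abs_ge0 p); have [h0 hf _ _] := hc.
have hp := component_self (riesz_abs_ge0 p) hc.
have hq : h (riesz_abs q) = 0.
  apply: component_disjoint hc _; rewrite ?riesz_abs_ge0//.
  by rewrite riesz_meetC.
(* A near-maximizer [t] with [|t| <= g] satisfies [t (A b) = 0], so the Arens value at [t] is within
   [e / 2] of [0]; the other [e / 2] is the defect of [t]. *)
have bound (X : forall i, order_bidual (E i)) (b : forall i, E (rho i)) (g : order_dual F) :
    (forall C, form_dom C (perm_form rho B) ->
      `|bidual_bars (fun i => X (rho i)) C - C b| <= e / 2) ->
    0 <= g -> g <= f -> g (riesz_abs (A (perm_family b))) = 0 ->
    riesz_abs (arens_extension rho A X) g <= e.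
  move=> Xb g0 gf gA; have [t [tg Xt]] := dual_abs_approx (arens_extension rho A X) g0 e20.
  have := Xb _ (perm_form_dom (rho := rho) (Bdom t (le_trans tg gf))).
  have := dual_abs_le tg (lexx (riesz_abs (A (perm_family b)))); rewrite gA.
  move: Xt; rewrite /= /arens_value /= !ler_norml => ? /andP[? ?] /andP[? ?]; lra.
exists (f - h), h; split=> //.
- by rewrite riesz_subr_ge0.
- by rewrite subrK.
- apply: (bound _ c) => [C /cP[]//|||].
  + by rewrite riesz_subr_ge0.
  + by rewrite riesz_leBl -[leLHS]addr0 riesz_leD2l.
  + by rewrite order_dualB hp subrr.
- by apply: (bound _ c') => // C /cP[].
Qed.
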